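(* Let $\mathcal{G}=(\mathcal{N},\mathcal{E})$ be a connected undirected communication graph with $n\ge 2$ nodes, and let $\mathcal{T}$, $D$, and $D_{\mathrm{avg}}$ be the rooted spanning tree, its depth and its average depth generated from $\mathcal{G}$ by the breadth-first tree construction. Suppose the smoothness assumption and the stochastic-oracle assumption hold, and define $$\Delta_f:=f(x^{(0)})-f^\star>0,\qquad H_0:=\frac1n\sum_{i=1}^n\|\nabla f_i(x^{(0)})\|^2.$$ For any integer iteration budget $T\ge 1$, run Tree-RGT with $$\gamma=\min\left\{\frac{\sqrt{\Delta_f}}{\sqrt{nTL\sigma^2}},\ \frac{1}{40nDL}\right\}.$$ Then its root trajectory satisfies $$\frac1T\sum_{t=0}^{T-1}\mathbb{E}\|\nabla f(x_1^{(t)})\|^2\le\frac{60\sqrt{\Delta_f L\sigma^2}}{\sqrt{nT}}+\frac{400D\Delta_f L}{T}+\frac{50D_{\mathrm{avg}}H_0}{T}.$$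
   Context: Problem: $f=\frac1n\sum_{i=1}^n f_i$, $f_i:\mathbb{R}^p\to\mathbb{R}$, agent $i\in\mathcal{N}=\{1,\dots,n\}$ holding $f_i$. Smoothness assumption: each $f_i$ is continuously differentiable with $L$-Lipschitz gradient ($\|\nabla f_i(x)-\nabla f_i(y)\|\le L\|x-y\|$ for all $x,y$), and $f^\star:=\inf_x f(x)>-\infty$. Stochastic-oracle assumption: samples $\xi_i^{(t)}\sim\mathcal{D}_i$, and the family $\{\xi_i^{(t)}:i\in\mathcal{N},t\ge0\}$ is mutually independent; for every $i$ and $x$, $\mathbb{E}_{\xi_i\sim\mathcal{D}_i}[g_i(x,\xi_i)]=\nabla f_i(x)$ and $\mathbb{E}_{\xi_i\sim\mathcal{D}_i}\|g_i(x,\xi_i)-\nabla f_i(x)\|^2\le\sigma^2$, for some $\sigma^2>0$. Tree construction: node $1$ is the prescribed root. Level-synchronous breadth-first search: $h_1=0$, $p(1)=1$; for $\ell=0,\dots,n-2$, every node with $h_i=\ell$ sends a message to all its neighbors in $\mathcal{G}$, and every not-yet-discovered node $j$ receiving at least one message takes the smallest-index sender as its parent $p(j)$ and sets $h_j=\ell+1$. Let $\mathrm{P}(i)=\{p(i)\}$ and $\mathrm{Ch}(i)=\{j\in\mathcal{N}:p(j)=i\}$ (so $1\in\mathrm{Ch}(1)$). The links $\{i,p(i)\}$, $i\ne1$, form a spanning tree $\mathcal{T}$ of $\mathcal{G}$, and $h_i$ is the distance from $1$ to $i$ in $\mathcal{T}$. Set $D:=\max_i h_i$ and $D_{\mathrm{avg}}:=\frac1n\sum_i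 h_i$. Tree-RGT: given $x^{(0)}\in\mathbb{R}^p$ and stepsize $\gamma>0$, set $x_i^{(0)}=x^{(0)}$ and $y_i^{(0)}=g_i(x_i^{(0)},\xi_i^{(0)})$ for all $i$. For $t=0,1,\dots$, with fresh samples $\xi_i^{(t+1)}$, $$x_1^{(t+1)}=x_1^{(t)}-\gamma y_1^{(t)},\qquad x_i^{(t+1)}=x_{p(i)}^{(t)}\ (i\ne1),$$ $$y_i^{(t+1)}=\sum_{j\in\mathrm{Ch}(i)}y_j^{(t)}+g_i(x_i^{(t+1)},\xi_i^{(t+1)})-g_i(x_i^{(t)},\xi_i^{(t)})\quad(i\in\mathcal{N}).$$ (The stochastic gradient $g_i(x_i^{(t)},\xi_i^{(t)})$ subtracted is the one evaluated at the previous step.) Expectations are over all randomness; $\|\cdot\|$ is Euclidean. *)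

(* Defs.v *)
From HB Require Import structures.
From mathcomp Require Import all_boot all_order all_algebra.
From mathcomp Require Import all_classical all_reals all_analysis.

Set Implicit Arguments.
Unset Strict Implicit.
Unset Printing Implicit Defensive.

Import Order.TTheory GRing.Theory Num.Theory.
Import numFieldNormedType.Exports.

Local Open Scope classical_set_scope.
Local Open Scope ring_scope.

Section Euclidean.
Variables (R : realType) (p : nat).

(* The library norm on ['rV[R]_p] is the sup norm, hence this definition. *)
Definition enorm (v : 'rV[R]_p) : R := Num.sqrt (\sum_(j < p) v 0 j ^+ 2).

Definition grad (f : 'rV[R]_p -> R) (x : 'rV[R]_p) : 'rV[R]_p :=
  \row_(j < p) 'D_(delta_mx 0 j) f x.

Definition C1 (f : 'rV[R]_p -> R) : Prop :=
  (forall x, differentiable f x) /\ continuous (grad f).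

Definition lipschitz_grad (L : R) (f : 'rV[R]_p -> R) : Prop :=
  forall x y, enorm (grad f x - grad f y) <= L * enorm (x - y).

Definition favg (n : nat) (f : 'I_n -> 'rV[R]_p -> R) (x : 'rV[R]_p) : R :=
  n%:R^-1 * \sum_(i < n) f i x.

Definition smoothness (n : nat) (L : R) (f : 'I_n -> 'rV[R]_p -> R) : Prop :=
  (forall i, C1 (f i) /\ lipschitz_grad L (f i)) /\
  has_lbound (range (favg f)).

End Euclidean.

Section Oracle.
Variables (R : realType) (p : nat).

(* The sigma-algebra on [p.-tuple R] is the product of the Borel ones, that is,
   the Borel sigma-algebra of R^p. Joint measurability is what makes the
   iterates random variables. *)
Definition jointly_measurable d (S : measurableType d)
    (g : 'rV[R]_p -> S -> 'rV[R]_p) : Prop :=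
  forall j : 'I_p,
    measurable_fun [set: p.-tuple R * S]
      (fun z : p.-tuple R * S => g (\row_k tnth z.1 k) z.2 0 j).

(* Expectations of vectors are taken coordinatewise. *)
Definition unbiased d (S : measurableType d) (Q : probability S R)
    (g : 'rV[R]_p -> S -> 'rV[R]_p) (f : 'rV[R]_p -> R) : Prop :=
  forall (x : 'rV[R]_p) (j : 'I_p),
    Q.-integrable [set: S] (EFin \o (fun s => g x s 0 j)) /\
    ('E_Q[fun s => (g x s 0 j)%R] = (grad f x 0 j)%:E)%E.

Definition bounded_variance d (S : measurableType d) (Q : probability S R)
    (g : 'rV[R]_p -> S -> 'rV[R]_p) (f : 'rV[R]_p -> R) (sigma2 : R) : Prop :=
  forall x : 'rV[R]_p,
    ('E_Q[fun s => (enorm (g x s - grad f x) ^+ 2)%R] <= sigma2%:E)%E.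

End Oracle.

Definition mutually_independent (R : realType) d (Omega : measurableType d)
    (P : probability Omega R) (I : eqType) (dS : I -> measure_display)
    (S : forall k, measurableType (dS k)) (X : forall k, Omega -> S k) : Prop :=
  forall (J : seq I) (A : forall k, set (S k)), uniq J ->
    (forall k, k \in J -> measurable (A k)) ->
    P (\bigcap_(k in [set` J]) (X k @^-1` A k)) =
    (\prod_(k <- J) P (X k @^-1` A k))%E.

Definition stochastic_oracle (R : realType) (p n : nat)
    (f : 'I_n -> 'rV[R]_p -> R)
    (dS : 'I_n -> measure_display) (S : forall i, measurableType (dS i))
    (D : forall i, probability (S i) R)
    (g : forall i, 'rV[R]_p -> S i -> 'rV[R]_p) (sigma2 : R)
    d (Omega : measurableType d) (P : probability Omega R)
    (xi : forall i, nat -> {RV P >-> S i}) : Prop :=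
  [/\ forall i (t : nat) (A : set (S i)), measurable A ->
        distribution P (xi i t) A = D i A,
      mutually_independent P (fun k : 'I_n * nat => xi k.1 k.2 : Omega -> S k.1),
      forall i, jointly_measurable (g i),
      forall i, unbiased (D i) (g i) (f i)
    & forall i, bounded_variance (D i) (g i) (f i) sigma2].

Section BFS.
Variables (n : nat) (e : rel 'I_n) (root : 'I_n).

(* [Some (h, q)]: discovered, at depth [h], with parent [q];
   [None]: not yet discovered. *)
Definition bfs_state := 'I_n -> option (nat * 'I_n).

Definition bfs_init : bfs_state :=
  fun i => if i == root then Some (0%N, root) else None.

Definition bfs_sender (s : bfs_state) (l : nat) (j i : 'I_n) : bool :=
  (omap fst (s i) == Some l) && e i j.

Definition bfs_round (l : nat) (s : bfs_state) : bfs_state := fun j =>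
  if s j is Some v then Some v
  else omap (fun i => (l.+1, i))
    [pick i | bfs_sender s l j i &
              [forall k : 'I_n, bfs_sender s l j k ==> (i <= k)%N]].

(* [bfs_after m] is the state after the rounds 0, ..., m - 1. *)
Fixpoint bfs_after (m : nat) : bfs_state :=
  if m is l.+1 then bfs_round l (bfs_after l) else bfs_init.

(* The defaults below are never used when the graph is connected. *)
Definition depth (i : 'I_n) : nat := oapp fst 0%N (bfs_after n.-1 i).
Definition parent (i : 'I_n) : 'I_n := oapp snd root (bfs_after n.-1 i).

Definition children (i : 'I_n) : {set 'I_n} := [set j | parent j == i].

Definition tree_depth : nat := \max_(i < n) depth i.

Definition avg_depth (R : realType) : R := n%:R^-1 * \sum_(i < n) (depth i)%:R.

End BFS.

Section TreeRGT.
Variables (R : realType) (p n : nat) (e : rel 'I_n) (root : 'I_n).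
Variables (dS : 'I_n -> measure_display) (S : forall i, measurableType (dS i)).
Variables (g : forall i, 'rV[R]_p -> S i -> 'rV[R]_p).
Variables (x0 : 'rV[R]_p) (gamma : R).

(* The pair (x^(t), y^(t)) along the realization [s] of the samples. *)
Fixpoint tree_rgt (s : forall i, nat -> S i) (t : nat) :
    ('I_n -> 'rV[R]_p) * ('I_n -> 'rV[R]_p) :=
  if t is t'.+1 then
    let x := (tree_rgt s t').1 in
    let y := (tree_rgt s t').2 in
    let x' := fun i => if i == root then x root - gamma *: y root
                       else x (parent e root i) in
    (x', fun i => \sum_(j in children e root i) y j
                  + g (x' i) (s i t'.+1) - g (x i) (s i t'))
  else (fun=> x0, fun i => g x0 (s i 0%N)).

End TreeRGT.

(* Main.v *)
Require Import Defs.
From HB Require Import structures.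
From mathcomp Require Import all_boot all_order all_algebra.
From mathcomp Require Import all_classical all_reals all_analysis.
From mathcomp Require Import measurable_realfun ring lra zify.

(** At its root, Tree-RGT is stochastic gradient descent with constant delays.
    Write [z t] for the root iterate and [h i] for the depth of node [i]. A
    node copies its parent, so it holds [z (t - h i)] at time [t]. The
    trackers move up one level per round and telescope at the root, so the
    root moves by [- gamma] times the sum over the nodes with [h i <= t] of
    the stochastic gradient of [f i] at [z (t - 2 * h i)], computed with the
    sample drawn at time [t - h i] ([tree_rgt_delayed_sgd]).

    This direction is split into its mean [v t] and a noise. The descent lemma
    for the average [f] is summed over time, and the inner product of [v t]
    with the gradient of [f] is expanded by polarization. This leaves a
    negative multiple of [|v t|^2] and a positive multiple of the squared bias
    [|v t - n * grad f (z t)|^2]. The bias has two sources. A gradient is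
    stale by [2 * h i] steps; the displacement over these steps is bounded by
    the energy of the [v s], which the negative term absorbs because
    [n * D * L * gamma <= 1 / 40], and by the noise accumulated meanwhile. A
    node with [t < h i] has not been heard at all; summed over time, the
    number of such nodes is at most the sum of the depths, whence the term
    with the average depth. All this holds for each sample path ([pathwise_bound]).

    Expectations enter only then. A sample affects the root for the first time
    in the step that uses it, and in that step the iterates involved depend on
    other samples only. Hence the noise is orthogonal to the mean directions,
    to the gradients, and to the noise of other steps and other nodes; in
    particular the noise accumulated over a window has a second moment that is
    linear in its length ([window_noise_sqr]), which keeps the depth out of
    the leading term. Conditional expectations are replaced by Fubini's
    theorem: a sample is independent of the sigma-algebra generated by all the
    others, so it can be integrated out first ([freezing]).

    The stepsize then balances the initial gap against the noise
    ([stepsize_tradeoff]). *)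

Set Implicit Arguments.
Unset Strict Implicit.
Unset Printing Implicit Defensive.

Import Order.TTheory GRing.Theory Num.Theory.
Import numFieldNormedType.Exports.

Local Open Scope classical_set_scope.
Local Open Scope ring_scope.

(** * Euclidean inner product and the descent lemma *)

Section Dot.
Context (R : realType) (p : nat).
Implicit Types u v w : 'rV[R]_p.

Definition dot u v : R := \sum_(j < p) u 0 j * v 0 j.

Lemma dotC u v : dot u v = dot v u.
Proof. by apply: eq_bigr => j _; rewrite mulrC. Qed.

Lemma dotDl u v w : dot (u + v) w = dot u w + dot v w.
Proof. by rewrite -big_split; apply: eq_bigr => j _; rewrite !mxE mulrDl. Qed.

Lemma dotZl a u v : dot (a *: u) v = a * dot u v.
Proof. by rewrite /dot mulr_sumr; apply: eq_bigr => j _; rewrite !mxE mulrA. Qed.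

Lemma dotDr u v w : dot u (v + w) = dot u v + dot u w.
Proof. by rewrite dotC dotDl !(dotC u). Qed.

Lemma dotZr a u v : dot u (a *: v) = a * dot u v.
Proof. by rewrite dotC dotZl (dotC u). Qed.

Lemma dotNl u v : dot (- u) v = - dot u v.
Proof. by rewrite -scaleN1r dotZl mulN1r. Qed.

Lemma dotNr u v : dot u (- v) = - dot u v.
Proof. by rewrite dotC dotNl dotC. Qed.

Definition dotE := (dotDl, dotDr, dotNl, dotNr, dotZl, dotZr).

Lemma dot_suml (J : Type) (r : seq J) (Q : pred J) (F : J -> 'rV[R]_p) v :
  dot (\sum_(i <- r | Q i) F i) v = \sum_(i <- r | Q i) dot (F i) v.
Proof.
apply: (big_morph (fun u => dot u v) (fun x y => dotDl x y v)).
by rewrite /dot big1// => j _; rewrite mxE mul0r.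
Qed.

Lemma dot_ge0 u : 0 <= dot u u.
Proof. by apply: sumr_ge0 => j _; rewrite -expr2 sqr_ge0. Qed.

Lemma enorm_sqr u : enorm u ^+ 2 = dot u u.
Proof.
rewrite /enorm sqr_sqrtr; last by apply: sumr_ge0 => j _; exact: sqr_ge0.
by apply: eq_bigr => j _; rewrite expr2.
Qed.

Lemma dot_sqrD_le u v : dot (u + v) (u + v) <= 2 * dot u u + 2 * dot v v.
Proof. by have := dot_ge0 (u - v); rewrite !dotE (dotC v u); lra. Qed.

Lemma sqr_sum_le (J : Type) (r : seq J) (Q : pred J) (a : J -> R) :
  (\sum_(i <- r | Q i) a i) ^+ 2 <=
  (count Q r)%:R * \sum_(i <- r | Q i) a i ^+ 2.
Proof.
elim: r => [|i r IH]; first by rewrite !big_nil expr0n mulr0.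
rewrite !big_cons /=; case: (Q i) => //=; rewrite add1n -natr1.
set s := \sum_(_ <- _ | _) _ in IH *; set m := (count Q r)%:R in IH *.
set q := \sum_(_ <- _ | _) _ in IH *.
have m0 : 0 <= m by rewrite ler0n.
have q0 : 0 <= q by apply: sumr_ge0 => j _; exact: sqr_ge0.
suff : 2 * a i * s <= m * a i ^+ 2 + q by nra.
(* Multiplied by [m], the claim follows from [(m * a i - s) ^+ 2 >= 0] and
   [s ^+ 2 <= m * q]; for [m = 0] the latter forces [s = 0]. *)
case: (ltgtP m 0) m0 => // [m0 _|m0 _].
  rewrite -(ler_pM2l m0); have := sqr_ge0 (m * a i - s); nra.
have -> : s = 0 by apply/eqP; rewrite -sqrf_eq0 eq_le sqr_ge0 (le_trans IH)// m0 mul0r.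
by rewrite mulr0 m0 mul0r add0r.
Qed.

Lemma dot_sum_le (J : Type) (r : seq J) (Q : pred J) (F : J -> 'rV[R]_p) :
  dot (\sum_(i <- r | Q i) F i) (\sum_(i <- r | Q i) F i) <=
  (count Q r)%:R * \sum_(i <- r | Q i) dot (F i) (F i).
Proof.
rewrite [in leRHS]/dot exchange_big mulr_sumr; apply: ler_sum => j _ /=.
rewrite -expr2 summxE; under [in leRHS]eq_bigr do rewrite -expr2.
exact: sqr_sum_le.
Qed.

End Dot.

Section Descent.
Context (R : realType) (p : nat).
Implicit Types (f : 'rV[R]_p -> R) (x y : 'rV[R]_p).

(** Squaring the Lipschitz condition turns it into a statement about [dot],
    the form in which the estimates on the trajectory use it. *)
Lemma lipschitz_grad_dot L f x y : 0 < L -> lipschitz_grad L f ->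
  dot (grad f x - grad f y) (grad f x - grad f y) <= L ^+ 2 * dot (x - y) (x - y).
Proof.
move=> L0 /(_ x y) lipf; rewrite -!enorm_sqr -exprMn lerXn2r ?nnegrE//.
  by rewrite sqrtr_ge0.
by rewrite mulr_ge0 ?sqrtr_ge0 ?ltW.
Qed.

(** [grad] is made of partial derivatives; differentiability is what makes
    it represent every directional derivative. *)
Lemma derive_dot f x v : differentiable f x -> 'D_v f x = dot (grad f x) v.
Proof.
move=> df; rewrite deriveE// {1}[v]row_sum_delta linear_sum.
apply: eq_bigr => j _; rewrite linearZ /= mulrC; congr (_ * _).
by rewrite mxE deriveE.
Qed.

Lemma is_derive_line f x v (s : R) : (forall y, differentiable f y) ->
  is_derive s 1 (fun s : R => f (x + s *: v)) (dot (grad f (x + s *: v)) v).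
Proof.
move=> df; have E : (fun h : R => h^-1 *:
     (((fun s : R => f (x + s *: v)) \o shift s) (h *: 1) - f (x + s *: v))) =
   (fun h : R => h^-1 *: ((f \o shift (x + s *: v)) (h *: v) - f (x + s *: v))).
  apply/funext => h /=; congr (_ *: (f _ - _)).
  by rewrite [h *: 1]mulr1 scalerDl addrCA addrC -addrA addrC -addrA.
have dv : derivable f (x + s *: v) v by exact: diff_derivable.
apply: DeriveDef; first by rewrite /derivable E.
by rewrite -derive_dot// /derive E.
Qed.

(** Along the segment from [x] to [y], the function minus its quadratic upper
    model has a nonpositive derivative, so it decreases by the mean value
    theorem. *)
Lemma descent L f x y : 0 < L -> (forall x, differentiable f x) ->
  lipschitz_grad L f ->
  f y <= f x + dot (grad f x) (y - x) + L / 2 * dot (y - x) (y - x).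
Proof.
move=> L0 df lipf; have [v vE] : exists v, v = y - x by exists (y - x).
rewrite -vE; have -> : y = x + v by rewrite vE addrCA subrr addr0.
pose c := dot (grad f x) v; pose N := dot v v.
pose psi (s : R) := f (x + s *: v) - s * c - L / 2 * N * s ^+ 2.
pose dpsi (s : R) := dot (grad f (x + s *: v)) v - c - L * N * s.
have dpsiE (s : R) : is_derive s 1 psi (dpsi s).
  have dl := is_derive_line x v s df.
  rewrite /psi; apply: is_derive_eq.
  by rewrite /dpsi scaler0 /GRing.scale /= !mulr1; lra.
have [t t01 E] : exists2 t, t \in `]0, 1[%R & psi 1 - psi 0 = dpsi t * (1 - 0).
  apply: MVT; first by [].
  apply: continuous_subspaceT => s.
  by apply/differentiable_continuous/derivable1_diffP; have [] := dpsiE s.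
move: t01; rewrite in_itv /= => /andP[t0 t1].
have Lt0 : 0 < L * t by rewrite mulr_gt0.
have : dpsi t <= 0.
  (* A weighted square replaces the Cauchy-Schwarz inequality. *)
  have := lipschitz_grad_dot (x + t *: v) x L0 lipf.
  rewrite [x + _ - x]addrC addKr /dpsi; set G := grad f _; set G0 := grad f x.
  have := dot_ge0 (G - G0 - (L * t) *: v).
  rewrite !dotE -/N !(dotC v) /c -/G0 => H1 H2.
  rewrite -(pmulr_rle0 _ Lt0); lra.
move: E; rewrite /psi scale1r scale0r addr0 -/N -/c; lra.
Qed.

Lemma grad_favg n (f : 'I_n -> 'rV[R]_p -> R) x :
  (forall i, differentiable (f i) x) ->
  grad (favg f) x = n%:R^-1 *: \sum_(i < n) grad (f i) x.
Proof.
move=> df; apply/rowP => j; rewrite !mxE summxE.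
have -> : favg f = n%:R^-1 \*o (\sum_(i < n) f i).
  by apply/funext => y; rewrite /favg /= fct_sumE.
rewrite deriveMl; last by apply: derivable_sum => i; exact: diff_derivable.
rewrite derive_sum; last by move=> i; exact: diff_derivable.
by congr (_ * _); apply: eq_bigr => i _; rewrite mxE.
Qed.

End Descent.

(** * The breadth-first tree *)

Section BFSTree.
Context (n : nat) (e : rel 'I_n) (root : 'I_n).
Hypothesis e_conn : forall i j, connect e i j.

Let st := bfs_after e root.

(** Entries of the table are never overwritten, so a node keeps the depth and
    the parent that it got when it was discovered. *)
Lemma bfs_after_mono (m k : nat) i v :
  (m <= k)%N -> st m i = Some v -> st k i = Some v.
Proof.
move=> mk sv; elim: k mk => [|k IH]; first by rewrite leqn0 => /eqP <-.
rewrite leq_eqVlt => /predU1P[<-//|]; rewrite ltnS => /IH.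
by rewrite /st /= /bfs_round -/st => ->.
Qed.

Lemma bfs_after_root m : st m root = Some (0%N, root).
Proof. by apply: (@bfs_after_mono 0) => //; rewrite /st /= /bfs_init eqxx. Qed.

(** The provenance of an entry: a node other than the root was discovered in
    some round [l] through a parent of depth [l]. *)
Variant bfs_entry m i (h : nat) (q : 'I_n) : Prop :=
| BfsRoot of i = root & h = 0%N & q = root
| BfsNode l r of i != root & h = l.+1 & (l < m)%N & st l q = Some (l, r)
    & st l.+1 i = Some (h, q).

Lemma bfs_afterP m i h q : st m i = Some (h, q) -> bfs_entry m i h q.
Proof.
elim: m => [|m IH] /=.
  by rewrite /st /= /bfs_init; case: eqP => // -> [<- <-]; exact: BfsRoot.
move=> sE; move: (sE); rewrite /st /= /bfs_round -/st.
case E : (st m i) => [v|].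
  move=> [vE]; rewrite vE in E; have [] := IH E; first by move=> *; exact: BfsRoot.
  by move=> l r ri hl lm sq si; apply: (BfsNode ri hl _ sq si); exact: leqW.
case: pickP => //= r /andP[/andP[sr eri] _] [hE qE]; subst h q.
have ri : i != root by apply: contra_eq_neq E => ->; rewrite bfs_after_root.
case F : (st m r) sr => [[l s]|]//= /eqP[lm]; subst l.
exact: (BfsNode ri erefl _ F sE).
Qed.

(** Among the senders there is one of smallest index, so a neighbour of a
    node of depth [l] is certainly reached in round [l]. *)
Lemma bfs_discovers l i j q : st l i = Some (l, q) -> e i j ->
  exists v, st l.+1 j = Some v.
Proof.
move=> si eij; rewrite /st /= /bfs_round -/st.
case: (st l j) => [v|]; first by exists v.
have Pi : bfs_sender e (st l) l j i by rewrite /bfs_sender si /= eqxx.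
case: pickP => [r _|]; first by exists (l.+1, r).
pose r := [arg min_(k < i | bfs_sender e (st l) l j k) (k : nat)].
move=> /(_ r) /negP[]; rewrite /r; case: arg_minnP => // k Pk minr.
by rewrite Pk; apply/forallP => k'; apply/implyP; exact: minr.
Qed.

(** The end of a path of length [k] is discovered after [k] rounds: the node
    before it has some depth at most [k - 1], and sends in the round of that
    number. *)
Lemma bfs_after_path s : path e root s ->
  exists v, st (size s) (last root s) = Some v.
Proof.
elim/last_ind: s => [_|s j IH]; first by exists (0%N, root); exact: bfs_after_root.
rewrite rcons_path last_rcons size_rcons => /andP[/IH[[h q] sE] ej].
have [_ h0 _|l r _ hl lm _ si] := bfs_afterP sE.
  have [|v jv] := @bfs_discovers h (last root s) j q _ ej.
  - have [lr _ qE|l r _ hl] := bfs_afterP sE; last by rewrite h0 in hl.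
    by rewrite lr h0 qE bfs_after_root.
  - by exists v; apply: bfs_after_mono jv; rewrite h0.
rewrite -hl in si.
by have [v jv] := bfs_discovers si ej; exists v; apply: bfs_after_mono jv; rewrite hl.
Qed.

(** A path without repetition has fewer than [n] edges, which is why
    [n - 1] rounds suffice. *)
Lemma bfs_all_discovered i : exists v, st n.-1 i = Some v.
Proof.
have [s es ->] := connectP (e_conn root i).
have [s' es' us' _] := shortenP es.
have [v sv] := bfs_after_path es'; exists v.
apply: bfs_after_mono sv; have /card_uniqP := us'.
rewrite /= => cE; have := max_card [in root :: s'].
rewrite cE card_ord /=; lia.
Qed.

Lemma depth_root : depth e root root = 0%N.
Proof. by rewrite /depth -/st bfs_after_root. Qed.

Lemma parent_root : parent e root root = root.
Proof. by rewrite /parent -/st bfs_after_root. Qed.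

Lemma depth_parent i : i != root ->
  depth e root i = (depth e root (parent e root i)).+1.
Proof.
move=> ri; have [[h q] iE] := bfs_all_discovered i.
have [iroot|l r _ hl lm sq _] := bfs_afterP iE; first by rewrite iroot eqxx in ri.
rewrite /parent /depth -/st iE /= hl.
by rewrite (bfs_after_mono (ltnW lm) sq).
Qed.

End BFSTree.

(** * At the root, Tree-RGT is stochastic gradient descent with delays *)

Section Unrolling.
Context (R : realType) (p n : nat) (e : rel 'I_n) (root : 'I_n).
Hypothesis e_conn : forall i j, connect e i j.
Context (dS : 'I_n -> measure_display) (S : forall i, measurableType (dS i)).
Context (g : forall i, 'rV[R]_p -> S i -> 'rV[R]_p).
Context (x0 : 'rV[R]_p) (gamma : R) (s : forall i, nat -> S i).

Let h := depth e root.
Let par := parent e root.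
Let x t := (tree_rgt e root g x0 gamma s t).1.
Let y t := (tree_rgt e root g x0 gamma s t).2.

(** Iterates travel down one level per round. The truncated subtraction
    accounts for the common starting point: before round [h i], node [i] still
    holds the initial iterate. *)
Lemma tree_rgt_delay t i : x t i = x (t - h i) root.
Proof.
elim: t i => [|t IH] i; first by rewrite sub0n.
have [->|ri] := eqVneq i root; first by rewrite /h depth_root subn0.
rewrite {1}/x /= -/(x t) (negbTE ri) IH.
by rewrite /h (depth_parent e_conn ri) subSS.
Qed.

Let G t i := g (x t i) (s i t).
(** The increment injected by node [i] at time [t], with the convention that
    the gradient before time 0 vanishes. *)
Let dG t i := if t is t'.+1 then G t i - G t' i else G 0 i.

Let y_step t i :
  y t.+1 i = \sum_(j in children e root i) y t j + dG t.+1 i.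
Proof. by rewrite /dG addrA. Qed.

Let y0 i : y 0 i = dG 0 i. Proof. by []. Qed.

Let h_eq0 i : (h i == 0%N) = (i == root).
Proof.
have [->|ri] := eqVneq i root; first by rewrite /h depth_root eqxx.
by rewrite /h (depth_parent e_conn ri).
Qed.

Let h_par l j : (0 < l)%N -> (h (par j) == l) = (h j == l.+1).
Proof.
move=> l0; have [->|rj] := eqVneq j root.
  by rewrite /par parent_root /h depth_root; case: l l0.
by rewrite /h (depth_parent e_conn rj) eqSS.
Qed.

(** Below the root the trackers forget: what a layer holds is passed on
    entirely to the layer above. Summing over a whole layer makes the shape of
    the subtrees irrelevant, and shows that at time [t] layer [l] holds
    exactly the increments injected [h i - l] rounds earlier. The layer [0] is
    excluded because the root is its own child and hence accumulates. *)
Lemma layer_sum t l : (0 < l)%N ->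
  \sum_(i | h i == l) y t i =
  \sum_(i | (l <= h i <= l + t)%N) dG (l + t - h i) i.
Proof.
elim: t l => [|t IH] l l0.
  apply: eq_big => [i|i /eqP ->]; first by rewrite addn0 -eqn_leq eq_sym.
  by rewrite addn0 subnn.
under eq_bigr do rewrite y_step; rewrite big_split /=.
have -> : \sum_(i | h i == l) \sum_(j in children e root i) y t j =
    \sum_(j | h j == l.+1) y t j.
  rewrite [RHS](partition_big par (fun i => h i == l)) /=; last first.
    by move=> j; rewrite h_par.
  apply: eq_bigr => i /eqP hil; apply: eq_bigl => j; rewrite inE -/(par j).
  by case: eqP => [E|_]; rewrite ?andbF// -h_par// E hil eqxx.
rewrite IH// addrC [RHS](bigID (fun i => h i == l)) /=; congr (_ + _).
  apply: eq_big => [i|i /eqP ->]; last by rewrite addKn.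
  by case: eqP => [->|]; rewrite ?andbF// leqnn leq_addr.
by apply: eq_big => [i|i _]; [lia|congr (dG _ _); lia].
Qed.

(** The root keeps every increment it receives, so that the increments of each
    node telescope to the latest gradient that had time to reach the root. *)
Lemma root_tracker t : y t root = \sum_(i | (h i <= t)%N) G (t - h i) i.
Proof.
elim: t => [|t IH].
  rewrite y0 (eq_bigl (pred1 root)) => [|i]; last by rewrite leqn0 h_eq0.
  by rewrite big_pred1_eq.
rewrite y_step.
have -> : \sum_(j in children e root root) y t j =
    y t root + \sum_(j | h j == 1%N) y t j.
  rewrite (bigD1 root) ?inE ?parent_root//=; congr (_ + _); apply: eq_bigl => j.
  rewrite inE; have [->|rj] := eqVneq j root; first by rewrite /h depth_root andbF.
  by rewrite andbT /h (depth_parent e_conn rj) eqSS h_eq0.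
rewrite IH layer_sum// big_mkcond [in X in _ + X + _]big_mkcond /= -big_split /=.
have -> : G t.+1 root - G t root =
    \sum_i if i == root then G t.+1 i - G t i else 0.
  by rewrite -big_mkcond big_pred1_eq.
rewrite [RHS]big_mkcond -big_split /=; apply: eq_bigr => i _.
have [->|ri] := eqVneq i root.
  by rewrite /h depth_root !subn0 /= addr0 addrC subrK.
have : (h i != 0)%N by rewrite h_eq0.
case: (h i) => // k _; rewrite add1n addr0 /= ltnS subSS.
have [kt|tk] := ltnP k t.
  by rewrite (ltnW kt) -(subnSK kt) /= addrC subrK.
rewrite add0r; case: leqP => // kt.
have -> : k = t by lia.
by rewrite subnn.
Qed.

(** A gradient used by the root is stale twice over: by [h i] rounds because
    the iterate had to go down to [i], and by [h i] more because the gradient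
    had to come back. *)
Lemma tree_rgt_delayed_sgd t :
  x t.+1 root = x t root - gamma *: \sum_(i | (h i <= t)%N)
    g (x (t - (h i).*2) root) (s i (t - h i)).
Proof.
rewrite {1}/x /= eqxx -/(x t) -/(y t) root_tracker.
congr (_ - _ *: _); apply: eq_bigr => i _.
by rewrite /G tree_rgt_delay -subnDA addnn.
Qed.

End Unrolling.

(** * Descent along a sample path *)

Section Windows.
Context (R : realType).
Implicit Type a : nat -> R.

Lemma sum_shift a m T :
  \sum_(0 <= t < T) (if (m < t)%N then a (t - m.+1)%N else 0) =
  \sum_(0 <= t < T - m.+1) a t.
Proof.
elim: T => [|T IH]; first by rewrite sub0n !big_geq.
rewrite big_nat_recr//= IH; case: ltnP => mT.
  by rewrite -big_nat_recr//= subSn.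
by rewrite addr0; have -> : (T.+1 - m.+1 = T - m.+1)%N by lia.
Qed.

(** Each term lies in at most [m] windows of length [m]. *)
Lemma sum_window_le a m T : (forall t, 0 <= a t) ->
  \sum_(0 <= t < T) \sum_(t - m <= s < t) a s <= m%:R * \sum_(0 <= t < T) a t.
Proof.
move=> a0; elim: m => [|m IH].
  by rewrite mul0r big1// => t _; rewrite subn0 big_geq.
rewrite -natr1 mulrDl mul1r.
have -> : \sum_(0 <= t < T) \sum_(t - m.+1 <= s < t) a s =
    \sum_(0 <= t < T) \sum_(t - m <= s < t) a s +
    \sum_(0 <= t < T) (if (m < t)%N then a (t - m.+1)%N else 0).
  rewrite -big_split /=; apply: eq_bigr => t _; case: ltnP => mt.
    by rewrite big_ltn ?ltn_subrL 1?addrC ?subnSK//; lia.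
  have -> : (t - m.+1 = t - m)%N by lia.
  by rewrite addr0.
apply: lerD => //; rewrite sum_shift.
rewrite [leRHS](big_cat_nat _ (n := (T - m.+1)%N))//=; last exact: leq_subr.
by rewrite lerDl sumr_ge0.
Qed.

(** The root waits for node [i] during [h i] rounds, here counted round by
    round. *)
Lemma sum_count_gt n (h : 'I_n -> nat) T :
  \sum_(0 <= t < T) (count (fun i => t < h i)%N (index_enum 'I_n))%:R
    <= \sum_(i < n) (h i)%:R :> R.
Proof.
under eq_bigr do rewrite -sum1_count natr_sum.
rewrite (exchange_big_dep xpredT)//=; apply: ler_sum => i _.
rewrite -natr_sum ler_nat.
suff -> : (\sum_(0 <= t < T | t < h i) 1 = minn T (h i))%N by exact: geq_minr.
elim: T => [|T IH]; first by rewrite big_geq// min0n.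
by rewrite big_mkcond big_nat_recr//= -big_mkcond IH; case: ltnP; lia.
Qed.

End Windows.

Section Pathwise.
Context (R : realType) (p n : nat).
Hypothesis n_gt0 : (0 < n)%N.
Context (f : 'I_n -> 'rV[R]_p -> R) (L : R).
Hypothesis L0 : 0 < L.
Hypothesis df : forall i x, differentiable (f i) x.
Hypothesis lipf : forall i, lipschitz_grad L (f i).

Let n0 : 0 < n%:R :> R. Proof. by rewrite ltr0n. Qed.

Lemma descent_favg x y :
  favg f y <= favg f x + dot (grad (favg f) x) (y - x) + L / 2 * dot (y - x) (y - x).
Proof.
rewrite grad_favg// dotZl dot_suml /favg.
have -> : L / 2 * dot (y - x) (y - x) =
    n%:R^-1 * \sum_(i < n) (L / 2 * dot (y - x) (y - x)).
  by rewrite sumr_const card_ord -(mulr_natl (L / 2 * _)) mulKf// gt_eqF.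
rewrite -!mulrDr -!big_split /= ler_pM2l ?invr_gt0//.
by apply: ler_sum => i _; exact: descent.
Qed.

Context (h : 'I_n -> nat) (D : nat).
Hypothesis hD : forall i, (h i <= D)%N.
Hypothesis D0 : (0 < D)%N.
Context (gamma : R) (z w : nat -> 'rV[R]_p).
Hypothesis gamma0 : 0 < gamma.
Hypothesis gammaD : 40 * n%:R * D%:R * L * gamma <= 1.

(** The mean direction of the root update, of which [n] times the gradient of
    the average is the undelayed counterpart. *)
Definition delayed_grad t :=
  \sum_(i | (h i <= t)%N) grad (f i) (z (t - (h i).*2)%N).

Local Notation v := delayed_grad.
Local Notation gr t := (grad (favg f) (z t)).

Hypothesis zS : forall t, z t.+1 = z t - gamma *: (v t + w t).

Lemma path_increment a b : (a <= b)%N ->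
  z b = z a - gamma *: \sum_(a <= s < b) (v s + w s).
Proof.
elim: b => [|b IH].
  by rewrite leqn0 => /eqP ->; rewrite big_geq// scaler0 subr0.
rewrite leq_eqVlt => /predU1P[<-|]; first by rewrite big_geq// scaler0 subr0.
rewrite ltnS => ab; rewrite zS IH// big_nat_recr//= [in RHS]scalerDr opprD addrA.
by [].
Qed.

(** For a node that has not been heard yet, the truncated index
    [t - 2 * h i] is [0]; adding and subtracting its initial gradient lets all
    nodes be treated as delayed, at the cost of a term that does not involve
    the trajectory. *)
Lemma bias_decomposition t :
  v t - n%:R *: gr t =
  \sum_(i < n) (grad (f i) (z (t - (h i).*2)%N) - grad (f i) (z t)) -
  \sum_(i | (t < h i)%N) grad (f i) (z 0%N).
Proof.
rewrite grad_favg// scalerA mulfV ?gt_eqF// scale1r sumrB addrAC; congr (_ - _).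
rewrite (bigID (fun i => (h i <= t)%N) xpredT) /=.
under [X in _ + X - _]eq_bigl do rewrite -ltnNge.
rewrite [X in _ = _ + X - _](eq_bigr (fun i => grad (f i) (z 0%N))); last first.
  by move=> i ti; congr (grad _ (z _)); lia.
by rewrite addrK.
Qed.

Let H := \sum_(i < n) dot (grad (f i) (z 0%N)) (grad (f i) (z 0%N)).

Definition drift t i :=
  dot (z (t - (h i).*2)%N - z t) (z (t - (h i).*2)%N - z t).

Lemma bias_le t :
  dot (v t - n%:R *: gr t) (v t - n%:R *: gr t) <=
  2 * n%:R * L ^+ 2 * \sum_(i < n) drift t i +
  2 * (count (fun i => t < h i)%N (index_enum 'I_n))%:R * H.
Proof.
rewrite bias_decomposition; apply: (le_trans (dot_sqrD_le _ _)).
rewrite -(mulrA 2 n%:R) -(mulrA 2 (n%:R * _)) -(mulrA n%:R) -(mulrA 2 _ H).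
apply: lerD; rewrite ler_pM2l//.
  apply: (le_trans (dot_sum_le _ _ _)).
  rewrite -sum1_count sum1_card card_ord ler_pM2l// mulr_sumr.
  by apply: ler_sum => i _; exact: lipschitz_grad_dot.
rewrite !dotE opprK; apply: (le_trans (dot_sum_le _ _ _)).
apply: ler_wpM2l; first by rewrite ler0n.
rewrite [leRHS](bigID (fun i => t < h i)%N) /= lerDl.
by apply: sumr_ge0 => i _; exact: dot_ge0.
Qed.

Definition noise_sum a b := \sum_(a <= s < b) w s.

(** The mean part of the displacement is bounded by the length of the window
    times its energy. The noise is kept as one vector: its expected square is
    only linear in the length of the window, which would be lost by bounding
    it term by term. *)
Lemma drift_le t i :
  drift t i <= gamma ^+ 2 *
   (2 * ((2 * D)%:R * \sum_(t - (h i).*2 <= s < t) dot (v s) (v s)) +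
    2 * dot (noise_sum (t - (h i).*2) t) (noise_sum (t - (h i).*2) t)).
Proof.
rewrite /drift; set a := (t - _)%N.
have at_ : (a <= t)%N by exact: leq_subr.
rewrite (path_increment at_) opprB addrCA subrr addr0 dotZl dotZr mulrA -expr2.
rewrite ler_pM2l ?exprn_gt0// big_split /=.
apply: (le_trans (dot_sqrD_le _ _)); rewrite lerD2r ler_pM2l//.
apply: (le_trans (dot_sum_le _ _ _)); apply: ler_wpM2r.
  by apply: sumr_ge0 => s _; exact: dot_ge0.
rewrite count_predT size_iota ler_nat /a; have := hD i; lia.
Qed.

Definition drift_noise T : R :=
  \sum_(0 <= t < T) \sum_(i < n)
    dot (noise_sum (t - (h i).*2) t) (noise_sum (t - (h i).*2) t).

Lemma sum_drift_le T :
  \sum_(0 <= t < T) \sum_(i < n) drift t i <=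
  gamma ^+ 2 * (8 * n%:R * D%:R ^+ 2 * \sum_(0 <= t < T) dot (v t) (v t) +
                2 * drift_noise T).
Proof.
set V := \sum_(0 <= t < T) dot (v t) (v t).
have V0 : 0 <= V by apply: sumr_ge0 => t _; exact: dot_ge0.
apply: (@le_trans _ _ (\sum_(0 <= t < T) \sum_(i < n) (gamma ^+ 2 *
   (2 * ((2 * D)%:R * \sum_(t - (h i).*2 <= s < t) dot (v s) (v s)) +
    2 * dot (noise_sum (t - (h i).*2) t) (noise_sum (t - (h i).*2) t))))).
  by apply: ler_sum => t _; apply: ler_sum => i _; exact: drift_le.
under eq_bigr do rewrite -mulr_sumr big_split /= -!mulr_sumr.
rewrite -mulr_sumr big_split /= -!mulr_sumr -/(drift_noise T).
rewrite ler_pM2l ?exprn_gt0// lerD2r exchange_big /=.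
apply: (@le_trans _ _ (2 * ((2 * D)%:R * \sum_(i < n) ((2 * D)%:R * V)))).
  rewrite ler_pM2l// ler_wpM2l ?ler0n//; apply: ler_sum => i _.
  apply: (le_trans (sum_window_le _ _ _)) => [t|]; first exact: dot_ge0.
  by rewrite ler_wpM2r// ler_nat; have := hD i; lia.
rewrite sumr_const card_ord -mulr_natl natrM; lra.
Qed.

(** The bound of the descent lemma after writing the inner product of the
    gradient with the mean direction as half of
    [n * |gr|^2 + |v|^2 / n - |v - n * gr|^2 / n]. *)
Definition step_change t : R :=
  - (gamma * n%:R / 2 * dot (gr t) (gr t))
    - (gamma / (2 * n%:R) - L * gamma ^+ 2 / 2) * dot (v t) (v t)
    + gamma / (2 * n%:R) * dot (v t - n%:R *: gr t) (v t - n%:R *: gr t)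
    + L * gamma ^+ 2 / 2 * dot (w t) (w t)
    + (L * gamma ^+ 2 * dot (v t) (w t) - gamma * dot (gr t) (w t)).

Lemma one_step t :
  favg f (z t.+1) <= favg f (z t) + step_change t.
Proof.
apply: (le_trans (descent_favg (z t) (z t.+1))); rewrite /step_change.
rewrite zS [z t - _ - _]addrAC subrr add0r -[leLHS]addrA lerD2l.
have [V VE] : exists V, V = v t by exists (v t).
have [G GE] : exists G, G = gr t by exists (gr t).
rewrite -VE -GE !dotE.
rewrite !(dotC (w t)) (dotC G V).
rewrite le_eqVlt; apply/orP; left; apply/eqP; field.
by rewrite gt_eqF.
Qed.

Lemma telescoped T :
  favg f (z T) <= favg f (z 0%N) + \sum_(0 <= t < T) step_change t.
Proof.
elim: T => [|T IH]; first by rewrite big_geq// addr0.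
apply: (le_trans (one_step T)).
by rewrite big_nat_recr//= [leRHS]addrA lerD2r.
Qed.

Lemma sum_bias_le T :
  \sum_(0 <= t < T) dot (v t - n%:R *: gr t) (v t - n%:R *: gr t) <=
  16 * n%:R ^+ 2 * L ^+ 2 * gamma ^+ 2 * D%:R ^+ 2 *
     \sum_(0 <= t < T) dot (v t) (v t)
  + 4 * n%:R * L ^+ 2 * gamma ^+ 2 * drift_noise T
  + 2 * (\sum_(i < n) (h i)%:R) * H.
Proof.
apply: (le_trans (ler_sum _ (fun t _ => bias_le t))).
rewrite big_split /= -mulr_sumr -mulr_suml -mulr_sumr; apply: lerD.
  apply: le_trans (ler_wpM2l _ (sum_drift_le T)) _; last by lra.
  by rewrite mulr_ge0 ?sqr_ge0// mulr_ge0// ltW.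
apply: ler_wpM2r; first by apply: sumr_ge0 => i _; exact: dot_ge0.
by rewrite ler_pM2l//; exact: sum_count_gt.
Qed.

(** Summing the descent inequality over time, for a single sample path. The
    energy of the mean directions that appears in the bias is absorbed by the
    negative term of the polarization identity, because
    [n * D * L * gamma <= 1 / 40]. What is left on the right is the initial
    gap, the cost of the nodes not heard yet, and the noise. *)
Lemma pathwise_bound (fs : R) T : (forall x, fs <= favg f x) ->
  gamma * n%:R / 2 * \sum_(0 <= t < T) dot (gr t) (gr t) <=
  favg f (z 0%N) - fs + gamma * (\sum_(i < n) (h i)%:R) * (n%:R^-1 * H)
  + L * gamma ^+ 2 / 2 * \sum_(0 <= t < T) dot (w t) (w t)
  + 2 * L ^+ 2 * gamma ^+ 3 * drift_noise T
  + \sum_(0 <= t < T) (L * gamma ^+ 2 * dot (v t) (w t) - gamma * dot (gr t) (w t)).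
Proof.
move=> /(_ (z T)) fsT; have := telescoped T.
rewrite /step_change !big_split /= !sumrN -!mulr_sumr.
have := sum_bias_le T.
set E := \sum_(0 <= t < T) dot (v t - n%:R *: gr t) (v t - n%:R *: gr t).
set V := \sum_(0 <= t < T) dot (v t) (v t).
set GG := \sum_(0 <= t < T) dot (gr t) (gr t).
set WW := \sum_(0 <= t < T) dot (w t) (w t).
set SH := \sum_(i < n) _; set N := drift_noise T.
set A := \sum_(0 <= t < T) dot (v t) (w t).
set B := \sum_(0 <= t < T) dot (gr t) (w t).
have V0 : 0 <= V by apply: sumr_ge0 => t _; exact: dot_ge0.
move=> EE tel.
have c0 : 0 < gamma / (2 * n%:R) by rewrite divr_gt0// mulr_gt0.
have EE' := ler_wpM2l (ltW c0) EE.
have cE : gamma / (2 * n%:R) * (16 * n%:R ^+ 2 * L ^+ 2 * gamma ^+ 2 * D%:R ^+ 2 * V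
  + 4 * n%:R * L ^+ 2 * gamma ^+ 2 * N + 2 * SH * H) =
  gamma / (2 * n%:R) * (16 * n%:R ^+ 2 * L ^+ 2 * gamma ^+ 2 * D%:R ^+ 2) * V
  + 2 * L ^+ 2 * gamma ^+ 3 * N + gamma * SH * (n%:R^-1 * H).
  by field; rewrite gt_eqF.
rewrite cE in EE'.
have VV : (gamma / (2 * n%:R) * (16 * n%:R ^+ 2 * L ^+ 2 * gamma ^+ 2 * D%:R ^+ 2)
   - (gamma / (2 * n%:R) - L * gamma ^+ 2 / 2)) * V <= 0.
  rewrite mulr_le0_ge0//.
  have -> : gamma / (2 * n%:R) * (16 * n%:R ^+ 2 * L ^+ 2 * gamma ^+ 2 * D%:R ^+ 2)
     - (gamma / (2 * n%:R) - L * gamma ^+ 2 / 2) =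
    gamma / (2 * n%:R) * (16 * (n%:R * D%:R * L * gamma) ^+ 2 + n%:R * L * gamma - 1).
    by field; rewrite gt_eqF.
  rewrite pmulr_rle0//.
  (* As [1 <= D], the coefficient is at most [16 * q ^+ 2 + q - 1]. *)
  set q := n%:R * D%:R * L * gamma.
  have q0 : 0 <= q by rewrite !mulr_ge0// ltW.
  have q1 : 40 * q <= 1 by rewrite /q !mulrA.
  have nq : n%:R * L * gamma <= q.
    rewrite /q -!mulrA ler_pM2l// ler_peMl ?ler1n// ltW// mulr_gt0//.
  nra.
lra.
Qed.

End Pathwise.

(** * Independence and freezing of one variable *)

Section Independence.
Context (R : realType) d (Omega : measurableType d) (P : probability Omega R).
Context (I : eqType) (dS : I -> measure_display).
Context (S : forall k, measurableType (dS k)).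
Variable X : forall k, {mfun Omega >-> S k}.
Hypothesis indepX : mutually_independent P (fun k => X k : Omega -> S k).

(** These sets form a pi-system that generates the sigma-algebra of all the
    variables but the [k]-th. *)
Definition cylinders_without (k : I) : set (set Omega) :=
  [set C | exists (J : seq I) (A : forall m, set (S m)),
    [/\ uniq J, k \notin J, forall m, measurable (A m)
      & C = \bigcap_(m in [set` J]) (X m @^-1` A m)]].

Definition others (k : I) : measurableType (sigma_display (cylinders_without k)) :=
  g_sigma_algebraType (cylinders_without k).

Lemma cylinders_without_measurable k : cylinders_without k `<=` measurable.
Proof.
move=> _ [J [A [_ _ mA ->]]]; apply: fin_bigcap_measurable => [|m _].
  exact: finite_seq.
by rewrite -[X in measurable X]setTI; exact: measurable_funP.
Qed.

Lemma cylinders_without_setI k : setI_closed (cylinders_without k).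
Proof.
move=> _ _ [J [A [uJ kJ mA ->]]] [K [B [uK kK mB ->]]].
pose E m : set (S m) := (if m \in J then A m else setT) `&`
                        (if m \in K then B m else setT).
exists (undup (J ++ K)), E; split.
- exact: undup_uniq.
- by rewrite mem_undup mem_cat negb_or kJ.
- by move=> m; apply: measurableI; case: ifP.
apply/seteqP; split => w /=.
  move=> [wJ wK] m /=; rewrite mem_undup mem_cat => _; split.
    by case: ifP => // mJ; exact: wJ.
  by case: ifP => // mK; exact: wK.
move=> wE; split=> m /= mJ; have /= := wE m; rewrite mem_undup mem_cat mJ ?orbT.
  by move=> /(_ erefl) []; rewrite mJ.
by move=> /(_ erefl) []; rewrite mJ.
Qed.

Lemma cylinders_withoutT k : cylinders_without k setT.
Proof.
exists [::], (fun=> setT); split => //.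
by apply/seteqP; split.
Qed.

Lemma measurable_others k m : m != k ->
  measurable_fun [set: others k] (X m : others k -> S m).
Proof.
move=> mk _ B mB; rewrite setTI; apply: sub_sigma_algebra.
exists [:: m], (dfwith (fun i => [set: S i]) m B); split => //.
- by rewrite inE eq_sym.
- by move=> i; case: dfwithP.
apply/seteqP; split => w /=.
  by move=> wB i /=; rewrite inE => /eqP ->; rewrite dfwithin.
by move=> /(_ m) /=; rewrite inE eqxx dfwithin; exact.
Qed.

Lemma measurable_from_others d' (T : measurableType d') k (h : Omega -> T) :
  measurable_fun [set: others k] (h : others k -> T) ->
  measurable_fun [set: Omega] h.
Proof.
move=> mh _ B mB; have := mh measurableT B mB.
apply: smallest_sub; first exact: sigma_algebra_measurable.
exact: cylinders_without_measurable.
Qed.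

Local Open Scope ereal_scope.

(** Mutual independence is the claim for cylinders; both sides are finite
    measures in [C], so they agree on the generated sigma-algebra. *)
Lemma others_independent k (C : set Omega) (B : set (S k)) :
  <<s cylinders_without k >> C -> measurable B ->
  P (C `&` X k @^-1` B) = P C * P (X k @^-1` B).
Proof.
move=> GC mB; set D := X k @^-1` B.
have mD : measurable D by rewrite -[D]setTI; exact: measurable_funP.
have PD0 : (0 <= fine (P D))%R by rewrite fine_ge0.
rewrite -[P D]fineK ?fin_num_measure// muleC.
rewrite -/(mscale (NngNum PD0) P C) -[LHS]/(mrestr P mD C).
apply: (@g_sigma_algebra_measure_unique _ _ _ _ (@cylinders_without_measurable k)
  (fun=> setT) (fun=> @cylinders_withoutT k) _
  (mrestr P mD) (mscale (NngNum PD0) P) (@cylinders_without_setI k)) => //.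
- by rewrite bigcup_const//; exists 0%N.
- move=> A [J [E [uJ kJ mE ->]]] /=.
  rewrite /mrestr /mscale /= fineK ?fin_num_measure//.
  pose F := dfwith E k B.
  have FE m : m \in J -> F m = E m.
    by move=> mJ; rewrite /F dfwithout//; apply: contraNneq kJ => ->.
  have mF m : measurable (F m) by rewrite /F; case: dfwithP.
  have := indepX (J := k :: J) (A := F).
  rewrite /= kJ uJ => /(_ erefl (fun m _ => mF m)).
  rewrite big_cons {2}/F dfwithin => PF.
  transitivity (P (\bigcap_(m in [set` k :: J]) (X m @^-1` F m))).
    congr (P _); apply/seteqP; split => w /=.
      move=> [wE wD] m /=; rewrite inE => /orP[/eqP ->|mJ].
        by rewrite /F dfwithin.
      by rewrite FE//; exact: wE.
    move=> wF; split=> [m /= mJ|].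
      by have /= := wF m; rewrite inE mJ orbT FE//; exact.
    by have /= := wF k; rewrite mem_head /F dfwithin; exact.
  rewrite PF; congr (_ * _); rewrite indepX//.
  by rewrite !big_seq; apply: eq_bigr => m mJ; rewrite FE.
- by move=> _; rewrite -ge0_fin_numE// fin_num_measure.
Qed.

Section Freezing.
Variable k : I.

Let past (w : Omega) : others k := w.

Let mpast : measurable_fun [set: Omega] past.
Proof. by apply: (@measurable_from_others _ _ k); exact: measurable_id. Qed.

HB.instance Definition _ := isMeasurableFun.Build _ _ _ _ past mpast.

Let joint (w : Omega) : others k * S k := (past w, X k w).

Let mjoint : measurable_fun [set: Omega] joint.
Proof. exact: measurable_fun_pair. Qed.

HB.instance Definition _ := isMeasurableFun.Build _ _ _ _ joint mjoint.

Let joint_law (A : set (others k * S k)) : measurable A ->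
  (distribution P past \x distribution P (X k)) A = distribution P joint A.
Proof.
apply: product_measure_unique => C B mC mB.
exact: others_independent.
Qed.

Let ge0_integral_joint (F : others k * S k -> \bar R) :
  measurable_fun [set: others k * S k] F -> (forall z, 0 <= F z) ->
  \int[distribution P past \x distribution P (X k)]_z F z =
  \int[P]_w F (w, X k w).
Proof.
move=> mF F0; transitivity (\int[distribution P joint]_z F z).
  by apply: eq_measure_integral => A mA _; exact: joint_law.
by rewrite ge0_integral_distribution.
Qed.

(** By independence the pair formed of the other variables and of [X k] has a
    product law, so that Fubini's theorem lets one integrate over [X k] with
    everything else frozen. This plays the role of a conditional
    expectation. *)
Lemma ge0_freezing (F : others k * S k -> \bar R) :
  measurable_fun [set: others k * S k] F -> (forall z, 0 <= F z) ->
  \int[P]_w F (w, X k w) =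
  \int[P]_w \int[distribution P (X k)]_s F (w, s).
Proof.
move=> mF F0; rewrite -ge0_integral_joint// fubini_tonelli1//.
rewrite ge0_integral_distribution//; first exact: measurable_fun_fubini_tonelli_F.
by move=> w; exact: integral_ge0.
Qed.

Lemma freezing (F : others k * S k -> \bar R) :
  measurable_fun [set: others k * S k] F ->
  P.-integrable [set: Omega] (fun w => F (w, X k w)) ->
  \int[P]_w F (w, X k w) =
  \int[P]_w \int[distribution P (X k)]_s F (w, s).
Proof.
move=> mF iF.
have maF : measurable_fun [set: others k * S k] (abse \o F).
  exact: measurableT_comp.
have iF' : (distribution P past \x distribution P (X k)).-integrable
    [set: others k * S k] F.
  apply/integrableP; split => //.
  rewrite [ltLHS](ge0_integral_joint maF (fun z => abse_ge0 (F z))).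
  by case/integrableP : iF.
transitivity (\int[distribution P joint]_z F z).
  by rewrite integral_distribution.
transitivity (\int[distribution P past \x distribution P (X k)]_z F z).
  by apply: eq_measure_integral => A mA _; exact/esym/joint_law.
rewrite -integral12_prod_meas1// integral_distribution//.
  exact: (measurable_fubini_F iF').
have := integrable_fubini_F iF'.
move/integrableP => [mG iG]; apply/integrableP; split.
  by apply: (@measurable_from_others _ _ k).
by move: iG; rewrite ge0_integral_distribution//; exact: measurableT_comp.
Qed.

End Freezing.

End Independence.

(** * Measurability and noise of an unbiased oracle *)

Definition measurable_rV (R : realType) p d (T : measurableType d)
    (Z : T -> 'rV[R]_p) : Prop :=
  forall j, measurable_fun [set: T] (fun w => Z w 0 j).

Section MeasurableVectors.
Context (R : realType) (p : nat) d (T : measurableType d).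
Implicit Types A B : T -> 'rV[R]_p.

Lemma measurable_rV_cst (c : 'rV[R]_p) : measurable_rV (fun _ : T => c).
Proof. by move=> j; exact: measurable_cst. Qed.

Lemma measurable_rVB A B : measurable_rV A -> measurable_rV B ->
  measurable_rV (fun w => A w - B w).
Proof.
by move=> mA mB j; under eq_fun do rewrite !mxE; exact: measurable_funB.
Qed.

Lemma measurable_rVZ c A : measurable_rV A -> measurable_rV (fun w => c *: A w).
Proof.
move=> mA j; under eq_fun do rewrite mxE.
by apply: measurable_funM => //; exact: measurable_cst.
Qed.

Lemma measurable_rV_sum (J : Type) (r : seq J) (Q : pred J)
    (F : J -> T -> 'rV[R]_p) : (forall i, Q i -> measurable_rV (F i)) ->
  measurable_rV (fun w => \sum_(i <- r | Q i) F i w).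
Proof.
move=> mF j.
rewrite (_ : (fun _ => _) = fun w => \sum_(i <- r) if Q i then F i w 0 j else 0).
  apply: measurable_sum => i; case: (boolP (Q i)) => [Qi|_]; last exact: measurable_cst.
  exact: mF.
by apply/funext => w; rewrite summxE big_mkcond.
Qed.

End MeasurableVectors.

Section OracleMeasurability.
Context (R : realType) (p : nat) d (S : measurableType d) (Q : probability S R).
Context (g : 'rV[R]_p -> S -> 'rV[R]_p) (f : 'rV[R]_p -> R).
Hypothesis mg : jointly_measurable g.

Lemma measurable_oracle d' (T : measurableType d') (Z : T -> 'rV[R]_p) j :
  measurable_rV Z ->
  measurable_fun [set: T * S] (fun z : T * S => g (Z z.1) z.2 0 j).
Proof.
move=> mZ; pose Zt w : p.-tuple R := [tuple Z w 0 i | i < p].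
have ZtE w : \row_i tnth (Zt w) i = Z w.
  by apply/rowP => i; rewrite mxE tnth_mktuple.
have mZt : measurable_fun [set: T] Zt.
  apply/measurable_fun_tnthP => i /=.
  rewrite (_ : _ \o _ = fun w => Z w 0 i); first exact: mZ.
  by apply/funext => w /=; rewrite tnth_mktuple.
rewrite (_ : (fun _ => _) = (fun z : p.-tuple R * S => g (\row_k tnth z.1 k) z.2 0 j)
    \o (fun z : T * S => (Zt z.1, z.2))).
  apply: measurableT_comp; first exact: mg.
  by apply: measurable_fun_pair => //; exact: measurableT_comp.
by apply/funext => z /=; rewrite ZtE.
Qed.

Lemma measurable_oracle_at d' (T : measurableType d') (Z : T -> 'rV[R]_p)
    (Y : T -> S) :
  measurable_rV Z -> measurable_fun [set: T] Y ->
  measurable_rV (fun w => g (Z w) (Y w)).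
Proof.
move=> mZ mY j.
apply: (@measurableT_comp _ _ _ _ _ _ (fun z : T * S => g (Z z.1) z.2 0 j) _
  (fun w => (w, Y w))); first exact: measurable_oracle.
by apply: measurable_fun_pair; [exact: measurable_id|exact: mY].
Qed.

Hypothesis unb : unbiased Q g f.

Lemma integral_oracle x j : (\int[Q]_s (g x s 0 j)%:E = (grad f x 0 j)%:E)%E.
Proof. by have [_ <-] := unb x j; rewrite unlock. Qed.

(** The gradient inherits measurability from the oracle of which it is the
    mean, by Fubini's theorem. *)
Lemma measurable_grad d' (T : measurableType d') (Z : T -> 'rV[R]_p) :
  measurable_rV Z -> measurable_rV (grad f \o Z).
Proof.
move=> mZ j; apply/measurable_EFinP.
pose F (z : T * S) := (g (Z z.1) z.2 0 j)%:E.
have mF : measurable_fun [set: T * S] F.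
  by apply/measurable_EFinP; exact: measurable_oracle.
rewrite (_ : _ \o _ =
    (fun w => \int[Q]_s F^\+%E (w, s) - \int[Q]_s F^\-%E (w, s))%E).
  apply: emeasurable_funB; apply: measurable_fun_fubini_tonelli_F => //.
    exact: measurable_funepos.
  exact: measurable_funeneg.
apply/funext => w; transitivity (\int[Q]_s F (w, s))%E.
  by rewrite /= -integral_oracle.
rewrite integralE; congr (_ - _)%E; apply: eq_integral => s _.
  by rewrite (funepos_comp F (pair w)).
by rewrite (funeneg_comp F (pair w)).
Qed.

End OracleMeasurability.

Section OracleNoise.
Context (R : realType) (p : nat) d (Omega : measurableType d)
  (P : probability Omega R).
Context (I : eqType) (dS : I -> measure_display).
Context (S : forall k, measurableType (dS k)) (X : forall k, {mfun Omega >-> S k}).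
Hypothesis indepX : mutually_independent P (fun k => X k : Omega -> S k).
Context (k : I) (Q : probability (S k) R).
Hypothesis XQ : forall A, measurable A -> distribution P (X k) A = Q A.
Context (g : 'rV[R]_p -> S k -> 'rV[R]_p) (f : 'rV[R]_p -> R) (sigma2 : R).
Hypothesis mg : jointly_measurable g.
Hypothesis unb : unbiased Q g f.
Hypothesis var : bounded_variance Q g f sigma2.
Context (Z : others X k -> 'rV[R]_p).
Hypothesis mZ : measurable_rV Z.

Local Open Scope ereal_scope.

(** Once the other variables are frozen, the factor [U] is a constant and the
    oracle is unbiased. *)
Lemma noise_mean0 (U : others X k -> R) j :
  measurable_fun [set: others X k] U ->
  P.-integrable [set: Omega]
    (fun w => (U w * (g (Z w) (X k w) 0 j - grad f (Z w) 0 j))%:E) ->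
  \int[P]_w (U w * (g (Z w) (X k w) 0 j - grad f (Z w) 0 j))%:E = 0.
Proof.
move=> mU iU.
pose F (z : others X k * S k) :=
  (U z.1 * (g (Z z.1) z.2 0 j - grad f (Z z.1) 0 j))%:E.
have mF : measurable_fun [set: others X k * S k] F.
  apply/measurable_EFinP; apply: measurable_funM.
    exact: measurableT_comp.
  apply: measurable_funB; first exact: (measurable_oracle mg j mZ).
  exact: (measurableT_comp (measurable_grad mg unb mZ j)).
transitivity (\int[P]_w F (w, X k w)); first by [].
rewrite (freezing indepX mF iU); apply: integral0_eq => w _.
rewrite (_ : \int[_]_s _ = \int[Q]_s F (w, s)); last first.
  by apply: eq_measure_integral => A mA _; exact: XQ.
have [ig _] := unb (Z w) j.
rewrite /F /=; under eq_integral do rewrite EFinM EFinB.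
rewrite integralZl//; last first.
  by apply: integrableB => //; exact: finite_measure_integrable_cst.
rewrite integralB//; last exact: finite_measure_integrable_cst.
rewrite (integral_oracle unb) integral_cst//.
rewrite [X in _ - _ * X](_ : _ = 1); last exact: probability_setT.
by rewrite mule1 subee// mule0.
Qed.

Lemma noise_variance :
  'E_P[fun w => (enorm (g (Z w) (X k w) - grad f (Z w)) ^+ 2)%R] <= sigma2%:E.
Proof.
pose F (z : others X k * S k) :=
  (enorm (g (Z z.1) z.2 - grad f (Z z.1)) ^+ 2)%:E.
have mF : measurable_fun [set: others X k * S k] F.
  apply/measurable_EFinP.
  rewrite (_ : (fun _ => _) = (fun z : others X k * S k =>
    (\sum_j (g (Z z.1) z.2 0 j - grad f (Z z.1) 0 j) ^+ 2)%R)); last first.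
    apply/funext => z; rewrite /enorm sqr_sqrtr ?sumr_ge0// => [|j _].
      by apply: eq_bigr => j _; rewrite !mxE.
    exact: sqr_ge0.
  apply: measurable_sum => j; apply: measurable_funX.
  apply: measurable_funB; first exact: (measurable_oracle mg j mZ).
  exact: (measurableT_comp (measurable_grad mg unb mZ j)).
have F0 z : 0 <= F z by rewrite lee_fin sqr_ge0.
rewrite unlock (_ : \int[P]_w _ = \int[P]_w F (w, X k w))//.
rewrite (ge0_freezing indepX mF F0).
have H w : \int[distribution P (X k)]_s F (w, s) <= sigma2%:E.
  rewrite (_ : \int[_]_s _ = \int[Q]_s F (w, s)); last first.
    by apply: eq_measure_integral => A mA _; exact: XQ.
  by have := var (Z w); rewrite unlock.
apply: (@le_trans _ _ (\int[P]_w sigma2%:E)).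
  apply: ge0_le_integral => //.
  - by move=> w _; exact: integral_ge0.
  - apply: (@measurable_from_others _ _ _ _ _ X _ _ k).
    exact: measurable_fun_fubini_tonelli_F.
rewrite integral_cst// [X in _ * X](_ : _ = 1); last exact: probability_setT.
by rewrite mule1.
Qed.

End OracleNoise.

(** * Square-integrable random vectors *)

Section SquareIntegrable.
Context (R : realType) d (Omega : measurableType d) (P : probability Omega R).
Implicit Types U V : Omega -> R.

Definition summable U := P.-integrable [set: Omega] (EFin \o U).

Definition square_summable U :=
  measurable_fun [set: Omega] U /\ summable (fun w => U w ^+ 2).

Lemma summable_cst (c : R) : summable (fun=> c).
Proof. exact: finite_measure_integrable_cst. Qed.

Lemma summableD U V : summable U -> summable V -> summable (fun w => U w + V w).
Proof. by move=> iU iV; exact: (integrableD measurableT iU iV). Qed.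

Lemma summableZ (c : R) U : summable U -> summable (fun w => c * U w).
Proof. by move=> iU; exact: (integrableZl measurableT c iU). Qed.

Lemma summableB U V : summable U -> summable V -> summable (fun w => U w - V w).
Proof. by move=> iU iV; exact: (integrableB measurableT iU iV). Qed.

Lemma summable_sum (J : Type) (r : seq J) (Q : pred J) (F : J -> Omega -> R) :
  (forall i, Q i -> summable (F i)) ->
  summable (fun w => \sum_(i <- r | Q i) F i w).
Proof.
move=> iF; rewrite /summable (_ : _ \o _ =
  (fun w => (\sum_(i <- r | Q i) (F i w)%:E)%E)).
  exact: integrable_sum.
by apply/funext => w; rewrite /= sumEFin.
Qed.

Lemma Rintegral_sum (J : Type) (r : seq J) (Q : pred J) (F : J -> Omega -> R) :
  (forall i, Q i -> summable (F i)) ->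
  (\int[P]_w \sum_(i <- r | Q i) F i w) = \sum_(i <- r | Q i) \int[P]_w F i w.
Proof.
move=> iF; elim: r => [|i r IH].
  rewrite big_nil; under eq_Rintegral do rewrite big_nil.
  by rewrite Rintegral_cst// mul0r.
rewrite big_cons; under eq_Rintegral do rewrite big_cons.
case: (boolP (Q i)) => // Qi; rewrite RintegralD// ?IH//; first exact: iF.
exact: summable_sum.
Qed.

Lemma le_summable U V : measurable_fun [set: Omega] U -> summable V ->
  (forall w, `|U w| <= V w) -> summable U.
Proof.
move=> mU iV UV; apply: le_integrable iV => //; first exact/measurable_EFinP.
by move=> w _ /=; rewrite lee_fin (le_trans (UV w))// ler_norm.
Qed.

Lemma square_summableM U V : square_summable U -> square_summable V ->
  summable (fun w => U w * V w).
Proof.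
move=> [mU iU] [mV iV]; apply: le_summable (summableD iU iV) _.
  exact: measurable_funM.
move=> w; rewrite normrM -[U w ^+ 2]real_normK ?num_real//.
rewrite -[V w ^+ 2]real_normK ?num_real//.
have := sqr_ge0 (`|U w| - `|V w|); have := normr_ge0 (U w).
have := normr_ge0 (V w); nra.
Qed.

Lemma square_summable_cst (c : R) : square_summable (fun=> c).
Proof. by split; [exact: measurable_cst|exact: summable_cst]. Qed.

Lemma square_summable_le U V : measurable_fun [set: Omega] U -> summable V ->
  (forall w, U w ^+ 2 <= V w) -> square_summable U.
Proof.
move=> mU iV UV; split => //; apply: le_summable iV _.
  exact: measurable_funX.
by move=> w; rewrite ger0_norm ?sqr_ge0.
Qed.

Lemma square_summableZ (c : R) U :
  square_summable U -> square_summable (fun w => c * U w).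
Proof.
move=> [mU iU]; apply: (square_summable_le _ (summableZ (c ^+ 2) iU)).
  exact: measurable_funM.
by move=> w; rewrite exprMn.
Qed.

Lemma square_summableD U V : square_summable U -> square_summable V ->
  square_summable (fun w => U w + V w).
Proof.
move=> [mU iU] [mV iV].
apply: (square_summable_le _ (summableZ 2 (summableD iU iV))).
  exact: measurable_funD.
by move=> w; have := sqr_ge0 (U w - V w); lra.
Qed.

Lemma square_summable_sum (J : Type) (r : seq J) (Q : pred J) (F : J -> Omega -> R) :
  (forall i, Q i -> square_summable (F i)) ->
  square_summable (fun w => \sum_(i <- r | Q i) F i w).
Proof.
move=> sF; elim: r => [|i r IH].
  under eq_fun do rewrite big_nil; exact: square_summable_cst.
under eq_fun do rewrite big_cons; case: (boolP (Q i)) => // Qi.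
by apply: square_summableD => //; exact: sF.
Qed.

Section Vectors.
Context (p : nat).
Implicit Types A B : Omega -> 'rV[R]_p.

Definition square_summable_rV A := forall j, square_summable (fun w => A w 0 j).

Lemma square_summable_rV_sum (J : Type) (r : seq J) (Q : pred J)
    (F : J -> Omega -> 'rV[R]_p) : (forall i, Q i -> square_summable_rV (F i)) ->
  square_summable_rV (fun w => \sum_(i <- r | Q i) F i w).
Proof.
move=> sF j; under eq_fun do rewrite summxE.
by apply: square_summable_sum => i Qi; exact: sF.
Qed.

Lemma square_summable_rVD A B : square_summable_rV A -> square_summable_rV B ->
  square_summable_rV (fun w => A w + B w).
Proof.
by move=> sA sB j; under eq_fun do rewrite mxE; exact: square_summableD.
Qed.

Lemma square_summable_rVZ c A : square_summable_rV A ->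
  square_summable_rV (fun w => c *: A w).
Proof. by move=> sA j; under eq_fun do rewrite mxE; exact: square_summableZ. Qed.

Lemma summable_dot A B : square_summable_rV A -> square_summable_rV B ->
  summable (fun w => dot (A w) (B w)).
Proof. by move=> sA sB; apply: summable_sum => j _; exact: square_summableM. Qed.

Lemma square_summable_rV_le A V : measurable_rV A -> summable V ->
  (forall w, dot (A w) (A w) <= V w) -> square_summable_rV A.
Proof.
move=> mA iV AV j; apply: square_summable_le iV _; first exact: mA.
move=> w; apply: le_trans (AV w); rewrite /dot (bigD1 j)//= -expr2 lerDl.
by apply: sumr_ge0 => i _; rewrite -expr2 sqr_ge0.
Qed.

(** Pythagoras: the expected square of a sum of orthogonal vectors is at most
    the number of terms times a common bound. *)
Lemma orthogonal_sum (J : eqType) (r : seq J) (Q : pred J)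
    (F : J -> Omega -> 'rV[R]_p) (c : R) : uniq r ->
  (forall i, Q i -> square_summable_rV (F i)) ->
  (forall i k, Q i -> Q k -> i != k -> \int[P]_w dot (F i w) (F k w) = 0) ->
  (forall i, Q i -> \int[P]_w dot (F i w) (F i w) <= c) ->
  \int[P]_w dot (\sum_(i <- r | Q i) F i w) (\sum_(i <- r | Q i) F i w) <=
  (count Q r)%:R * c.
Proof.
move=> ur sF oF cF.
have E w : dot (\sum_(i <- r | Q i) F i w) (\sum_(i <- r | Q i) F i w) =
    \sum_(i <- r | Q i) \sum_(k <- r | Q k) dot (F i w) (F k w).
  rewrite dot_suml; apply: eq_bigr => i _.
  by rewrite dotC dot_suml; apply: eq_bigr => k _; rewrite dotC.
under eq_Rintegral do rewrite E.
rewrite Rintegral_sum; last first.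
  move=> i Qi; apply: summable_sum => k Qk.
  by apply: summable_dot; exact: sF.
rewrite mulr_natl -[count Q r]sum1_count -sumrMnr big_seq_cond [leRHS]big_seq_cond.
apply: ler_sum => i /andP[ir Qi]; rewrite Rintegral_sum; last first.
  by move=> k Qk; apply: summable_dot; exact: sF.
rewrite -big_filter (bigD1_seq i) ?mem_filter ?Qi ?filter_uniq//=.
rewrite big_seq_cond big1 ?addr0 ?mulr1n ?cF// => k.
rewrite mem_filter => /andP[/andP[Qk _] ki].
by apply: oF => //; rewrite eq_sym.
Qed.

End Vectors.
End SquareIntegrable.

(** * Orthogonality of the noise of the root iterates *)

Section DelayedSGD.
Context (R : realType) (p n : nat).
Context (f : 'I_n -> 'rV[R]_p -> R).
Context (dS : 'I_n -> measure_display) (S : forall i, measurableType (dS i)).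
Context (Dist : forall i, probability (S i) R).
Context (g : forall i, 'rV[R]_p -> S i -> 'rV[R]_p) (sigma2 : R).
Context d (Omega : measurableType d) (P : probability Omega R).
Context (xi : forall i, nat -> {RV P >-> S i}).
Hypothesis oracle : stochastic_oracle f Dist g sigma2 xi.
Context (h : 'I_n -> nat) (gamma : R) (x0 : 'rV[R]_p).
Context (z : nat -> Omega -> 'rV[R]_p).
Hypothesis z0 : forall w, z 0%N w = x0.
Hypothesis zS : forall t w, z t.+1 w = z t w - gamma *:
  \sum_(i | (h i <= t)%N) g (z (t - (h i).*2) w) (xi i (t - h i) w).

Let X (k : 'I_n * nat) : {mfun Omega >-> S k.1} := xi k.1 k.2.

Let indepX : mutually_independent P (fun k => X k : Omega -> S k.1).
Proof. by case: oracle. Qed.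
Let law i t A : measurable A -> distribution P (X (i, t)) A = Dist i A.
Proof. by case: oracle => + _ _ _ _; exact. Qed.
Let mg i : jointly_measurable (@g i).
Proof. by case: oracle. Qed.
Let unb i : unbiased (Dist i) (@g i) (f i).
Proof. by case: oracle. Qed.
Let var i : bounded_variance (Dist i) (@g i) (f i) sigma2.
Proof. by case: oracle. Qed.

(** The iterate of time [t] is determined by the samples that reached the root
    strictly before. The source [T] is arbitrary so that the lemma applies to
    the sub-sigma-algebras of [Omega] as well as to [Omega] itself. *)
Lemma measurable_iterate d' (T : measurableType d') (phi : T -> Omega) t :
  (forall j r, (r + h j < t)%N -> measurable_fun [set: T] (xi j r \o phi)) ->
  measurable_rV (z t \o phi).
Proof.
elim/ltn_ind: t => -[_ _|t IH mxi].
  by rewrite (_ : _ \o _ = fun=> x0); [exact: measurable_rV_cst|apply/funext => w; exact: z0].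
rewrite (_ : _ \o _ = fun w => z t (phi w) - gamma *: \sum_(i | (h i <= t)%N)
    g (z (t - (h i).*2) (phi w)) (xi i (t - h i) (phi w))); last first.
  by apply/funext => w /=; rewrite zS.
apply: measurable_rVB.
  by apply: (IH t) => // i r rt; apply: mxi; rewrite ltnS ltnW.
apply: measurable_rVZ; apply: measurable_rV_sum => i hit.
have mz : measurable_rV (z (t - (h i).*2) \o phi).
  apply: IH; first by rewrite ltnS leq_subr.
  by move=> k r krt; apply: mxi; lia.
have mx : measurable_fun [set: T] (xi i (t - h i) \o phi).
  by apply: mxi; rewrite subnK.
exact: (measurable_oracle_at (@mg i) mz mx).
Qed.

Definition noise t i w :=
  g (z (t - (h i).*2) w) (xi i (t - h i) w) - grad (f i) (z (t - (h i).*2) w).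

Definition step_noise t w := \sum_(i | (h i <= t)%N) noise t i w.

(** The sample of node [i] that reaches the root at time [t] is the one drawn
    at time [t - h i]; this is the sigma-algebra of all the others. *)
Let fresh i t := others X (i, (t - h i)%N).

Lemma measurable_past_iterate i t s : (h i <= t)%N -> (s <= t)%N ->
  measurable_rV (z s : fresh i t -> 'rV[R]_p).
Proof.
move=> hit st; apply: (@measurable_iterate _ (fresh i t) id) => j r rs.
have jr : (j, r) != (i, t - h i)%N.
  by apply: contraTneq rs => -[-> ->]; rewrite subnK// -leqNgt.
exact: (@measurable_others _ _ _ _ _ X _ _ jr).
Qed.

Lemma measurable_past_grad k i t s : (h i <= t)%N -> (s <= t)%N ->
  measurable_rV ((fun w => grad (f k) (z s w)) : fresh i t -> 'rV[R]_p).
Proof.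
move=> hit st.
exact: (measurable_grad (@mg k) (@unb k) (measurable_past_iterate hit st)).
Qed.

(** For a fixed node the samples reach the root in the order in which they are
    drawn, so a noise of an earlier step, or of another node in the same step,
    involves other samples only. *)
Lemma measurable_past_noise i t j s : (h i <= t)%N -> (h j <= s)%N ->
  (s < t)%N || (s == t) && (j != i) ->
  measurable_rV (noise s j : fresh i t -> 'rV[R]_p).
Proof.
move=> hit hjs st.
have sst : (s - (h j).*2 <= t)%N by move: st => /orP[|/andP[/eqP]]; lia.
apply: measurable_rVB; last exact: measurable_past_grad.
apply: (measurable_oracle_at (@mg j)); first exact: measurable_past_iterate.
have jr : (j, s - h j)%N != (i, t - h i)%N.
  apply: contraTneq st => -[ji]; rewrite ji eqxx andbF orbF -leqNgt => si.
  move: hit hjs si; rewrite ji; lia.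
exact: (@measurable_others _ _ _ _ _ X _ _ jr).
Qed.

Lemma measurable_of_past i t (A : Omega -> 'rV[R]_p) :
  measurable_rV (A : fresh i t -> 'rV[R]_p) -> measurable_rV A.
Proof. by move=> mA j; exact: (measurable_from_others (mA j)). Qed.

Lemma measurable_noise t i : (h i <= t)%N -> measurable_rV (noise t i).
Proof.
by move=> hit; apply: (@measurable_of_past i t.+1); apply: measurable_past_noise;
  rewrite ?ltnSn// leqW.
Qed.

Lemma noise_second_moment t i : (h i <= t)%N ->
  (\int[P]_w (dot (noise t i w) (noise t i w))%:E <= sigma2%:E)%E.
Proof.
move=> hit; under eq_integral do rewrite -enorm_sqr.
have := @noise_variance _ _ _ _ _ _ _ _ X indepX (i, t - h i)%N (Dist i)
  (@law i _) _ _ _ (@mg i) (@unb i) (@var i) _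
  (measurable_past_iterate hit (leq_subr (h i).*2 t)).
by rewrite unlock.
Qed.

Lemma summable_noise_sqr t i : (h i <= t)%N ->
  summable P (fun w => dot (noise t i w) (noise t i w)).
Proof.
move=> hit; apply/integrableP; split.
  apply/measurable_EFinP; apply: measurable_sum => j.
  by apply: measurable_funM; exact: measurable_noise.
apply: le_lt_trans (ltry sigma2); apply: le_trans (noise_second_moment hit).
by under eq_integral do rewrite /= ger0_norm ?dot_ge0//.
Qed.

Lemma square_summable_noise t i : (h i <= t)%N ->
  square_summable_rV P (noise t i).
Proof.
by move=> hit; apply: square_summable_rV_le (summable_noise_sqr hit) _ => //;
  exact: measurable_noise.
Qed.

Lemma Rintegral_noise_sqr t i : (h i <= t)%N ->
  \int[P]_w dot (noise t i w) (noise t i w) <= sigma2.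
Proof.
move=> hit; rewrite -lee_fin /Rintegral fineK; first exact: noise_second_moment.
exact: integrable_fin_num (summable_noise_sqr hit).
Qed.

Lemma noise_orthogonal t i (A : Omega -> 'rV[R]_p) : (h i <= t)%N ->
  square_summable_rV P A -> measurable_rV (A : fresh i t -> 'rV[R]_p) ->
  \int[P]_w dot (A w) (noise t i w) = 0.
Proof.
move=> hit sA mA; rewrite Rintegral_sum; last first.
  by move=> j _; apply: square_summableM; [exact: sA|exact: square_summable_noise].
apply: big1 => j _.
have := @noise_mean0 _ _ _ _ _ _ _ _ X indepX (i, t - h i)%N (Dist i)
  (@law i _) _ _ (@mg i) (@unb i) _
  (measurable_past_iterate hit (leq_subr (h i).*2 t)) (fun w => A w 0 j) j (mA j).
have E : (fun w => A w 0 j * noise t i w 0 j) = (fun w => (A w 0 j *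
  (g (z (t - (h i).*2) w) (xi i (t - h i) w) 0 j -
   grad (f i) (z (t - (h i).*2) w) 0 j))).
  by apply/funext => w; rewrite /noise !mxE.
have iAn : summable P (fun w => A w 0 j * noise t i w 0 j).
  by apply: square_summableM; [exact: sA|exact: square_summable_noise].
rewrite E in iAn *.
by move=> /(_ iAn) H; rewrite /Rintegral H.
Qed.

Lemma square_summable_step_noise t : square_summable_rV P (step_noise t).
Proof.
by apply: square_summable_rV_sum => i; exact: square_summable_noise.
Qed.

Lemma step_noise_orthogonal t (A : Omega -> 'rV[R]_p) :
  square_summable_rV P A ->
  (forall i, (h i <= t)%N -> measurable_rV (A : fresh i t -> 'rV[R]_p)) ->
  \int[P]_w dot (A w) (step_noise t w) = 0.
Proof.
move=> sA mA.
under eq_Rintegral do rewrite dotC dot_suml.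
under eq_Rintegral do under eq_bigr do rewrite dotC.
rewrite Rintegral_sum; last first.
  by move=> i hit; apply: summable_dot => //; exact: square_summable_noise.
by apply: big1 => i hit; apply: noise_orthogonal => //; exact: mA.
Qed.

Lemma step_noise_uncorrelated s t : (s < t)%N ->
  \int[P]_w dot (step_noise s w) (step_noise t w) = 0.
Proof.
move=> st; apply: step_noise_orthogonal; first exact: square_summable_step_noise.
move=> i hit; apply: measurable_rV_sum => k hks.
by apply: measurable_past_noise => //; rewrite st.
Qed.

Lemma step_noise_sqr t :
  \int[P]_w dot (step_noise t w) (step_noise t w) <=
  (count (fun i => h i <= t)%N (index_enum 'I_n))%:R * sigma2.
Proof.
apply: orthogonal_sum.
- exact: index_enum_uniq.
- by move=> i; exact: square_summable_noise.
- move=> i k hit hkt ik; apply: noise_orthogonal => //.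
    exact: square_summable_noise.
  by apply: measurable_past_noise => //; rewrite eqxx ik orbT.
- by move=> i; exact: Rintegral_noise_sqr.
Qed.

(** Noises of different steps are orthogonal, hence a bound that is linear,
    not quadratic, in the length of the window. *)
Lemma window_noise_sqr a b : 0 <= sigma2 ->
  \int[P]_w dot (\sum_(a <= s < b) step_noise s w) (\sum_(a <= s < b) step_noise s w)
    <= (b - a)%:R * (n%:R * sigma2).
Proof.
move=> s0; rewrite -(size_iota a (b - a)) -[size _](count_predT).
apply: orthogonal_sum.
- exact: iota_uniq.
- by move=> t _; exact: square_summable_step_noise.
- move=> s t _ _; rewrite neq_ltn => /orP[|ts]; first exact: step_noise_uncorrelated.
  by under eq_Rintegral do rewrite dotC; exact: step_noise_uncorrelated.
- move=> t _; apply: le_trans (step_noise_sqr t) _; rewrite ler_wpM2r//.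
  rewrite ler_nat (leq_trans (count_size _ _))//.
  by rewrite -count_predT -sum1_count sum1_card card_ord.
Qed.

Context (L : R).
Hypothesis L0 : 0 < L.
Hypothesis lipf : forall i, lipschitz_grad L (f i).

Lemma square_summable_grad i (A : Omega -> 'rV[R]_p) : measurable_rV A ->
  square_summable_rV P A -> square_summable_rV P (fun w => grad (f i) (A w)).
Proof.
move=> mA sA; pose c := grad (f i) x0.
apply: (@square_summable_rV_le _ _ _ _ _ _
  (fun w => 2 * (L ^+ 2 * dot (A w + -1 *: x0) (A w + -1 *: x0)) + 2 * dot c c)).
- exact: (measurable_grad (@mg i) (@unb i) mA).
- apply: summableD; last exact: summable_cst.
  apply: summableZ; apply: summableZ; apply: summable_dot;
  by apply: square_summable_rVD => // j; exact: square_summable_cst.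
- move=> w; rewrite scaleN1r -[X in dot X X](subrK c).
  apply: (le_trans (dot_sqrD_le _ _)); rewrite lerD2r ler_pM2l//.
  exact: lipschitz_grad_dot.
Qed.

Lemma measurable_z t : measurable_rV (z t).
Proof. by apply: (@measurable_iterate _ _ id) => j r _; exact: measurable_funP. Qed.

Lemma square_summable_iterate t : square_summable_rV P (z t).
Proof.
elim/ltn_ind: t => -[_ j|t IH].
  by under eq_fun do rewrite z0; exact: square_summable_cst.
have -> : z t.+1 = fun w => z t w + (- gamma) *: \sum_(i | (h i <= t)%N)
    (noise t i w + grad (f i) (z (t - (h i).*2) w)).
  apply/funext => w; rewrite zS scaleNr; congr (_ - _ *: _).
  by apply: eq_bigr => i _; rewrite /noise subrK.
apply: square_summable_rVD; first exact: IH.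
apply: square_summable_rVZ; apply: square_summable_rV_sum => i hit.
apply: square_summable_rVD; first exact: square_summable_noise.
apply: square_summable_grad; first exact: measurable_z.
by apply: IH; rewrite ltnS leq_subr.
Qed.

Lemma square_summable_grad_iterate i t :
  square_summable_rV P (fun w => grad (f i) (z t w)).
Proof.
by apply: square_summable_grad; [exact: measurable_z|exact: square_summable_iterate].
Qed.

End DelayedSGD.

(** * Expected descent and the choice of the stepsize *)

Section ExpectedDescent.
Context (R : realType) (p n : nat).
Hypothesis n_gt0 : (0 < n)%N.
Context (f : 'I_n -> 'rV[R]_p -> R) (L : R).
Hypothesis L0 : 0 < L.
Hypothesis df : forall i x, differentiable (f i) x.
Hypothesis lipf : forall i, lipschitz_grad L (f i).
Context (dS : 'I_n -> measure_display) (S : forall i, measurableType (dS i)).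
Context (Dist : forall i, probability (S i) R).
Context (g : forall i, 'rV[R]_p -> S i -> 'rV[R]_p) (sigma2 : R).
Hypothesis sigma2_ge0 : 0 <= sigma2.
Context d (Omega : measurableType d) (P : probability Omega R).
Context (xi : forall i, nat -> {RV P >-> S i}).
Hypothesis oracle : stochastic_oracle f Dist g sigma2 xi.
Context (h : 'I_n -> nat) (D : nat) (gamma : R) (x0 : 'rV[R]_p).
Hypothesis hD : forall i, (h i <= D)%N.
Hypothesis D0 : (0 < D)%N.
Hypothesis gamma0 : 0 < gamma.
Hypothesis gammaD : 40 * n%:R * D%:R * L * gamma <= 1.
Context (z : nat -> Omega -> 'rV[R]_p).
Hypothesis z0 : forall w, z 0%N w = x0.
Hypothesis zS : forall t w, z t.+1 w = z t w - gamma *: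
  \sum_(i | (h i <= t)%N) g (z (t - (h i).*2) w) (xi i (t - h i) w).

Local Notation eta := (step_noise f g xi h z).
Local Notation v t w := (delayed_grad f h (z^~ w) t).
Local Notation gr t w := (grad (favg f) (z t w)).

Let zS_noise w t : z t.+1 w = z t w - gamma *: (v t w + eta t w).
Proof.
rewrite zS; congr (_ - _ *: _); rewrite -big_split; apply: eq_bigr => i _ /=.
by rewrite /noise addrCA subrr addr0.
Qed.

Lemma square_summable_delayed_grad t : square_summable_rV P (fun w => v t w).
Proof.
apply: square_summable_rV_sum => i _.
exact: (square_summable_grad_iterate oracle z0 zS L0 lipf).
Qed.

Let gr_sum t : (fun w => gr t w) =
  (fun w => n%:R^-1 *: \sum_(i < n) grad (f i) (z t w)).
Proof. by apply/funext => w; rewrite grad_favg. Qed.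

Lemma square_summable_grad_favg t : square_summable_rV P (fun w => gr t w).
Proof.
rewrite gr_sum; apply: square_summable_rVZ; apply: square_summable_rV_sum => i _.
exact: (square_summable_grad_iterate oracle z0 zS L0 lipf).
Qed.

Lemma delayed_grad_noise t : \int[P]_w dot (v t w) (eta t w) = 0.
Proof.
apply: (step_noise_orthogonal oracle z0 zS (square_summable_delayed_grad t)).
move=> i hit; apply: measurable_rV_sum => k _.
exact: (measurable_past_grad oracle z0 zS k hit (leq_subr _ _)).
Qed.

Lemma grad_favg_noise t : \int[P]_w dot (gr t w) (eta t w) = 0.
Proof.
apply: (step_noise_orthogonal oracle z0 zS (square_summable_grad_favg t)).
move=> i hit; rewrite gr_sum; apply: measurable_rVZ; apply: measurable_rV_sum => k _.
exact: (measurable_past_grad oracle z0 zS k hit (leqnn t)).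
Qed.

Let sq_eta t : square_summable_rV P (eta t).
Proof. exact: (square_summable_step_noise oracle z0 zS). Qed.

(** In expectation the inner products with the noise vanish and the squares of
    the noise are controlled by [sigma2]. *)
Lemma expected_descent (fs : R) T : (forall x, fs <= favg f x) ->
  gamma * n%:R / 2 * \sum_(0 <= t < T) \int[P]_w dot (gr t w) (gr t w) <=
  favg f x0 - fs
  + gamma * (\sum_(i < n) (h i)%:R) *
    (n%:R^-1 * \sum_(i < n) dot (grad (f i) x0) (grad (f i) x0))
  + L * gamma ^+ 2 / 2 * (T%:R * (n%:R * sigma2))
  + 2 * L ^+ 2 * gamma ^+ 3 * (T%:R * (n%:R * ((2 * D)%:R * (n%:R * sigma2)))).
Proof.
move=> fsf; set C1 := favg f x0 - fs; set C2 := gamma * (\sum_(i < n) _) * _.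
pose A w := \sum_(0 <= t < T) dot (eta t w) (eta t w).
pose W t i w := \sum_(t - (h i).*2 <= s < t) eta s w.
pose B w := \sum_(0 <= t < T) \sum_(i < n) dot (W t i w) (W t i w).
pose N w := \sum_(0 <= t < T) (L * gamma ^+ 2 * dot (v t w) (eta t w)
                               - gamma * dot (gr t w) (eta t w)).
have sW t i : square_summable_rV P (W t i).
  by apply: square_summable_rV_sum => s _.
have iA : summable P A.
  by apply: summable_sum => t _; exact: summable_dot.
have iB : summable P B.
  by apply: summable_sum => t _; apply: summable_sum => i _; exact: summable_dot.
have iv t : summable P (fun w => dot (v t w) (eta t w)).
  by apply: summable_dot => //; exact: square_summable_delayed_grad.
have ig t : summable P (fun w => dot (gr t w) (eta t w)).
  by apply: summable_dot => //; exact: square_summable_grad_favg.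
have iN : summable P N.
  by apply: summable_sum => t _; apply: summableB; exact: summableZ.
have igg t : summable P (fun w => dot (gr t w) (gr t w)).
  by apply: summable_dot; exact: square_summable_grad_favg.
have iG : summable P (fun w => \sum_(0 <= t < T) dot (gr t w) (gr t w)).
  by apply: summable_sum => t _.
have EA : \int[P]_w A w <= T%:R * (n%:R * sigma2).
  rewrite Rintegral_sum; last by move=> t _; exact: summable_dot.
  rewrite -[T in T%:R]subn0 -sumr_const_nat mulr_suml; apply: ler_sum => t _.
  rewrite mul1r; apply: le_trans (step_noise_sqr oracle z0 zS t) _.
  rewrite ler_wpM2r// ler_nat (leq_trans (count_size _ _))//.
  by rewrite -count_predT -sum1_count sum1_card card_ord.
have EB : \int[P]_w B w <= T%:R * (n%:R * ((2 * D)%:R * (n%:R * sigma2))).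
  rewrite Rintegral_sum; last first.
    by move=> t _; apply: summable_sum => i _; exact: summable_dot.
  rewrite -[T in T%:R]subn0 -sumr_const_nat mulr_suml; apply: ler_sum => t _.
  rewrite mul1r Rintegral_sum; last by move=> i _; exact: summable_dot.
  rewrite -[X in X%:R * _]card_ord -sumr_const mulr_suml; apply: ler_sum => i _.
  rewrite mul1r; apply: le_trans (window_noise_sqr oracle z0 zS _ _ sigma2_ge0) _.
  rewrite ler_wpM2r ?mulr_ge0// ler_nat; have := hD i; lia.
have EC : \int[P]_w (C1 + C2) = C1 + C2.
  rewrite Rintegral_cst// [X in _ * X](_ : _ = 1) ?mulr1//.
  exact: (congr1 fine (probability_setT P)).
have EN : \int[P]_w N w = 0.
  rewrite Rintegral_sum; last first.
    by move=> t _; apply: summableB; exact: summableZ.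
  apply: big1 => t _; rewrite RintegralB//; [|exact: summableZ|exact: summableZ].
  rewrite RintegralZl//; last exact: iv.
  rewrite RintegralZl//; last exact: ig.
  rewrite [X in _ * X - _](delayed_grad_noise t).
  rewrite [X in _ - _ * X](grad_favg_noise t).
  by rewrite !mulr0 subrr.
have : \int[P]_w (gamma * n%:R / 2 * \sum_(0 <= t < T) dot (gr t w) (gr t w)) <=
  \int[P]_w (C1 + C2 + L * gamma ^+ 2 / 2 * A w
             + 2 * L ^+ 2 * gamma ^+ 3 * B w + N w).
  apply: le_Rintegral => //; first exact: summableZ.
    apply: summableD => //; apply: summableD; last exact: summableZ.
    apply: summableD; last exact: summableZ.
    exact: summable_cst.
  move=> w _.
  have := @pathwise_bound _ _ _ n_gt0 f L L0 df lipf h D hD D0 gamma (z^~ w)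
    (eta^~ w) gamma0 gammaD (zS_noise w) fs T fsf.
  by rewrite z0.
rewrite RintegralZl// Rintegral_sum//.
rewrite RintegralD//; last first.
  apply: summableD; last exact: summableZ.
  by apply: summableD; [exact: summable_cst|exact: summableZ].
rewrite RintegralD//; [|by apply: summableD; [exact: summable_cst|exact: summableZ]
  |exact: summableZ].
rewrite RintegralD//; [|exact: summable_cst|exact: summableZ].
rewrite !RintegralZl// EN addr0 EC => H; apply: le_trans H _; apply: lerD; [apply: lerD => //|].
  by rewrite ler_wpM2l// divr_ge0// mulr_ge0 ?ltW// exprn_gt0.
by rewrite ler_wpM2l// !mulr_ge0 ?ltW// exprn_gt0.
Qed.

End ExpectedDescent.

(** The stepsize is the smaller of two, so its inverse is at most the sum of
    the two inverses: the first one balances the initial gap against the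
    noise, the second one enforces [40 * n * D * L * gamma <= 1], which makes
    the noise accumulated during the delays at most one fifth of the fresh
    noise. *)
Lemma stepsize_tradeoff (R : realType) (Delta L sigma2 n T D G K gamma : R) :
  0 < Delta -> 0 < L -> 0 < sigma2 -> 0 < n -> 0 < T -> 0 < D -> 0 <= K ->
  gamma = Num.min (Num.sqrt Delta / Num.sqrt (n * T * L * sigma2))
                  (40 * n * D * L)^-1 ->
  gamma * n / 2 * G <= Delta + gamma * (n * K)
    + L * gamma ^+ 2 / 2 * (T * (n * sigma2))
    + 2 * L ^+ 2 * gamma ^+ 3 * (T * (n * (2 * D * (n * sigma2)))) ->
  T^-1 * G <= 60 * Num.sqrt (Delta * L * sigma2) / Num.sqrt (n * T)
    + 400 * D * Delta * L / T + 50 * K / T.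
Proof.
move=> Delta0 L0 s0 n0 T0 D0 K0.
have -> : n * T * L * sigma2 = (n * T) * (L * sigma2) by ring.
have -> : Delta * L * sigma2 = Delta * (L * sigma2) by ring.
rewrite (sqrtrM _ (ltW (mulr_gt0 n0 T0))) (sqrtrM _ (ltW Delta0)).
rewrite (sqrtrM _ (ltW n0)) (sqrtrM _ (ltW L0)).
have : Num.sqrt Delta ^+ 2 = Delta by rewrite sqr_sqrtr// ltW.
have : Num.sqrt n ^+ 2 = n by rewrite sqr_sqrtr// ltW.
have : Num.sqrt T ^+ 2 = T by rewrite sqr_sqrtr// ltW.
have : Num.sqrt L ^+ 2 = L by rewrite sqr_sqrtr// ltW.
have : Num.sqrt sigma2 ^+ 2 = sigma2 by rewrite sqr_sqrtr// ltW.
have a0 : 0 < Num.sqrt Delta by rewrite sqrtr_gt0.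
have b0 : 0 < Num.sqrt n by rewrite sqrtr_gt0.
have c0 : 0 < Num.sqrt T by rewrite sqrtr_gt0.
have d0 : 0 < Num.sqrt L by rewrite sqrtr_gt0.
have e0 : 0 < Num.sqrt sigma2 by rewrite sqrtr_gt0.
set a := Num.sqrt Delta in a0 *; set b := Num.sqrt n in b0 *.
set c := Num.sqrt T in c0 *; set l := Num.sqrt L in d0 *.
set s := Num.sqrt sigma2 in e0 *.
move=> sE lE cE bE aE.
set g1 := a / (b * c * (l * s)); set g2 := (40 * n * D * L)^-1 => gammaE bound.
have g10 : 0 < g1 by rewrite divr_gt0// !mulr_gt0.
have g20 : 0 < g2 by rewrite invr_gt0 !mulr_gt0.
have gamma0 : 0 < gamma by rewrite gammaE lt_min g10.
have gg1 : gamma <= g1 by rewrite gammaE ge_min lexx.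
have gg2 : gamma <= g2 by rewrite gammaE ge_min lexx orbT.
have Vgamma : gamma^-1 <= g1^-1 + g2^-1.
  by rewrite gammaE; case: (leP g1 g2) => _; rewrite ?lerDl ?lerDr invr_ge0 ltW.
have q1 : 40 * (n * D * L * gamma) <= 1.
  have := gg2; rewrite /g2 -[(_)^-1]mul1r ler_pdivlMr ?mulr_gt0//; lra.
(* The factor 6/5 is 1 for the fresh noise and 8/40 for the accumulated one. *)
have step : T^-1 * G <= 2 * (Delta / (n * T) * gamma^-1) + 2 * K / T
    + 6 / 5 * (L * sigma2 * gamma).
  have k0 : 0 < gamma * n * T / 2 by rewrite divr_gt0// !mulr_gt0.
  rewrite -(ler_pM2l k0).
  have -> : gamma * n * T / 2 * (T^-1 * G) = gamma * n / 2 * G.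
    by field; rewrite gt_eqF.
  apply: (le_trans bound).
  have -> : gamma * n * T / 2 * (2 * (Delta / (n * T) * gamma^-1) + 2 * K / T
      + 6 / 5 * (L * sigma2 * gamma)) =
    Delta + gamma * (n * K) + 6 / 10 * (L * sigma2 * gamma ^+ 2 * n * T).
    by field; rewrite !gt_eqF.
  have m0 : 0 <= L * sigma2 * gamma ^+ 2 * n * T.
    by rewrite !mulr_ge0// ?ltW// exprn_gt0.
  have := ler_wpM2r m0 q1; lra.
apply: (le_trans step).
have main : L * sigma2 * gamma <= a * (l * s) / (b * c).
  have -> : a * (l * s) / (b * c) = L * sigma2 * g1.
    rewrite /g1 -lE -sE; field; by rewrite !gt_eqF.
  by rewrite ler_wpM2l// mulr_ge0// ltW.
have first : Delta / (n * T) * gamma^-1 <= a * (l * s) / (b * c)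
    + 40 * D * Delta * L / T.
  have nT0 : 0 <= Delta / (n * T) by rewrite ltW// divr_gt0// mulr_gt0.
  apply: le_trans (ler_wpM2l nT0 Vgamma) _.
  rewrite le_eqVlt; apply/orP; left; apply/eqP.
  rewrite mulrDr; congr (_ + _).
    by rewrite /g1 -aE -bE -cE; field; rewrite !gt_eqF.
  by rewrite /g2 invrK; field; rewrite !gt_eqF.
have r0 : 0 <= a * (l * s) / (b * c) by rewrite ltW// divr_gt0// !mulr_gt0.
have t0 : 0 <= D * Delta * L / T by rewrite ltW// divr_gt0// !mulr_gt0.
have k0 : 0 <= K / T by rewrite divr_ge0// ltW.
lra.
Qed.

(** * Convergence of Tree-RGT *)

Theorem theorem4p2 (R : realType) (p n : nat) (hn : (1 < n)%N)
  (e : rel 'I_n) (e_sym : symmetric e) (e_irr : irreflexive e)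
  (e_conn : forall i j, connect e i j)
  (f : 'I_n -> 'rV[R]_p -> R) (L : R) (L_gt0 : 0 < L)
  (f_smooth : smoothness L f)
  (dS : 'I_n -> measure_display) (S : forall i, measurableType (dS i))
  (Dist : forall i, probability (S i) R)
  (g : forall i, 'rV[R]_p -> S i -> 'rV[R]_p)
  (sigma2 : R) (sigma2_gt0 : 0 < sigma2)
  (d : measure_display) (Omega : measurableType d) (P : probability Omega R)
  (xi : forall i, nat -> {RV P >-> S i})
  (oracle : stochastic_oracle f Dist g sigma2 xi)
  (x0 : 'rV[R]_p) (T : nat) (hT : (1 <= T)%N) :
  let node1 : 'I_n := Ordinal (ltnW hn) in
  let D : R := (tree_depth e node1)%:R in
  let Davg : R := avg_depth e node1 R in
  let Delta : R := favg f x0 - inf (range (favg f)) in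
  let H0 : R := n%:R^-1 * \sum_(i < n) enorm (grad (f i) x0) ^+ 2 in
  let gamma : R :=
    Num.min (Num.sqrt Delta / Num.sqrt (n%:R * T%:R * L * sigma2))
            (40 * n%:R * D * L)^-1 in
  let x (t : nat) (i : 'I_n) (w : Omega) : 'rV[R]_p :=
    (tree_rgt e node1 g x0 gamma (fun j k => xi j k w) t).1 i in
  0 < Delta ->
  ((T%:R^-1)%:E *
     (\sum_(0 <= t < T) 'E_P[fun w => (enorm (grad (favg f) (x t node1 w)) ^+ 2)%R])
   <= (60 * Num.sqrt (Delta * L * sigma2) / Num.sqrt (n%:R * T%:R)
       + 400 * D * Delta * L / T%:R
       + 50 * Davg * H0 / T%:R)%:E)%E.
Proof.
move=> node1 D Davg Delta H0 gamma x Delta0.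
case: f_smooth => smooth lb.
have df i y : differentiable (f i) y by case: (smooth i) => -[+ _] _; exact.
have lipf i : lipschitz_grad L (f i) by case: (smooth i).
have n0 : (0 < n)%N by exact: ltnW.
have nR0 : 0 < n%:R :> R by rewrite ltr0n.
have T0 : 0 < T%:R :> R by rewrite ltr0n.
pose h := depth e node1; pose Dn := tree_depth e node1.
have hD i : (h i <= Dn)%N by exact: leq_bigmax.
have Dn0 : (0 < Dn)%N.
  apply: leq_trans (hD (Ordinal hn)).
  by rewrite /h (depth_parent e_conn).
have D0 : 0 < D by rewrite ltr0n.
have gamma0 : 0 < gamma.
  by rewrite lt_min divr_gt0 ?sqrtr_gt0 ?invr_gt0 ?mulr_gt0.
have gammaD : 40 * n%:R * D * L * gamma <= 1.
  have : gamma <= (40 * n%:R * D * L)^-1 by rewrite ge_min lexx orbT.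
  by rewrite -[X in _ <= X]mul1r ler_pdivlMr ?mulr_gt0// mulrC.
pose z t w := x t node1 w.
have z0 w : z 0%N w = x0 by [].
have zS t w : z t.+1 w = z t w - gamma *: \sum_(i | (h i <= t)%N)
    g i (z (t - (h i).*2)%N w) (xi i (t - h i)%N w).
  exact: (tree_rgt_delayed_sgd node1 e_conn g x0 gamma (fun j k => xi j k w) t).
have fs y : inf (range (favg f)) <= favg f y by apply: ge_inf => //; exists y.
have iG t : summable P (fun w =>
    dot (grad (favg f) (z t w)) (grad (favg f) (z t w))).
  by apply: summable_dot;
    exact: (square_summable_grad_favg L_gt0 df lipf oracle z0 zS).
pose E t := \int[P]_w dot (grad (favg f) (z t w)) (grad (favg f) (z t w)).
have EE t : ('E_P[fun w => (enorm (grad (favg f) (x t node1 w)) ^+ 2)%R]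
    = (E t)%:E)%E.
  rewrite unlock; under eq_integral do rewrite enorm_sqr.
  by rewrite fineK//; exact: integrable_fin_num (iG t).
under eq_bigr do rewrite EE.
rewrite sumEFin -EFinM lee_fin -[50 * Davg * H0]mulrA.
apply: (stepsize_tradeoff (gamma := gamma) Delta0 L_gt0 sigma2_gt0 nR0 T0 D0 _ erefl).
  apply: mulr_ge0; apply: mulr_ge0; rewrite ?invr_ge0 ?ler0n//; apply: sumr_ge0 => i _.
    by rewrite ler0n.
  by rewrite sqr_ge0.
have := expected_descent n0 L_gt0 df lipf (ltW sigma2_gt0) oracle hD Dn0 gamma0
  gammaD z0 zS T fs.
have -> : n%:R * (Davg * H0) = (\sum_(i < n) (h i)%:R) *
    (n%:R^-1 * \sum_(i < n) dot (grad (f i) x0) (grad (f i) x0)).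
  have -> : H0 = n%:R^-1 * \sum_(i < n) dot (grad (f i) x0) (grad (f i) x0).
    by congr (_ * _); apply: eq_bigr => i _; rewrite enorm_sqr.
  by rewrite /Davg /avg_depth -!mulrA mulVKf ?gt_eqF.
by rewrite natrM -(mulrA gamma (\sum_(i < n) _)).
Qed.
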